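(* Let $H$ be a separable Hilbert space, $1\le p<\infty$, and $S$ a bounded linear operator on $H$ (not assumed compact). The following are equivalent: (i) $S\in S_p$; (ii) there is a constant $C>0$ with $\sum_{n=1}^\infty|\langle Se_n,e_n\rangle|^p\le C$ for every orthonormal basis $\{e_n\}$; (iii) there is a constant $C>0$ with $\sum_{n=1}^\infty|\langle Sf_n,f_n\rangle|^p\le C$ for every frame $\{f_n\}$ with upper frame bound at most $1$.
   Context: A sequence $\{f_n\}$ in $H$ is a frame if there are constants $0<C_1\le C_2$ such that $C_1\|f\|^2\le\sum_n|\langle f,f_n\rangle|^2\le C_2\|f\|^2$ for all $f\in H$. The upper frame bound is the infimum of all admissible $C_2$. For a compact operator $T$, its singular values $\lambda_1\ge\lambda_2\ge\cdots$ are the positive eigenvalues of $(T^*T)^{1/2}$, repeated according to multiplicity. For $0<p<\infty$, $S_p$ is the set of compact $T$ with $\{\lambda_n\}\in\ell^p$. *)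

(* Defs.v *)
From Stdlib Require Import Reals List.
Open Scope R_scope.

Definition C := (R * R)%type.
Definition C0 : C := (0, 0).
Definition C1 : C := (1, 0).
Definition RtoC (r : R) : C := (r, 0).
Definition Cadd (z w : C) : C := (fst z + fst w, snd z + snd w).
Definition Cmul (z w : C) : C :=
  (fst z * fst w - snd z * snd w, fst z * snd w + snd z * fst w).
Definition Cconj (z : C) : C := (fst z, - snd z).
Definition Cmod (z : C) : R := sqrt (fst z ^ 2 + snd z ^ 2).

Record HilbertSpace := mkHS {
  hcar :> Type;
  h0 : hcar;
  hadd : hcar -> hcar -> hcar;
  hopp : hcar -> hcar;
  hscal : C -> hcar -> hcar;
  hinner : hcar -> hcar -> C;
  hadd_assoc : forall x y z, hadd x (hadd y z) = hadd (hadd x y) z;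
  hadd_comm : forall x y, hadd x y = hadd y x;
  hadd_0 : forall x, hadd x h0 = x;
  hadd_opp : forall x, hadd x (hopp x) = h0;
  hscal_1 : forall x, hscal C1 x = x;
  hscal_assoc : forall a b x, hscal a (hscal b x) = hscal (Cmul a b) x;
  hscal_distr_v : forall a x y, hscal a (hadd x y) = hadd (hscal a x) (hscal a y);
  hscal_distr_s : forall a b x, hscal (Cadd a b) x = hadd (hscal a x) (hscal b x);
  hinner_conj : forall x y, hinner y x = Cconj (hinner x y);
  hinner_add_l : forall x y z, hinner (hadd x y) z = Cadd (hinner x z) (hinner y z);
  hinner_scal_l : forall a x y, hinner (hscal a x) y = Cmul a (hinner x y);
  hinner_pos : forall x, 0 <= fst (hinner x x);
  hinner_def : forall x, hinner x x = C0 -> x = h0;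
  hcomplete : forall u : nat -> hcar,
    (forall eps, 0 < eps -> exists N, forall m n, (N <= m)%nat -> (N <= n)%nat ->
       sqrt (fst (hinner (hadd (u m) (hopp (u n))) (hadd (u m) (hopp (u n))))) < eps) ->
    exists l, forall eps, 0 < eps -> exists N, forall n, (N <= n)%nat ->
       sqrt (fst (hinner (hadd (u n) (hopp l)) (hadd (u n) (hopp l)))) < eps;
  hseparable : exists d : nat -> hcar, forall x eps, 0 < eps -> exists n,
       sqrt (fst (hinner (hadd x (hopp (d n))) (hadd x (hopp (d n))))) < eps
}.

Arguments h0 {h}.
Arguments hadd {h}.
Arguments hopp {h}.
Arguments hscal {h}.
Arguments hinner {h}.

Definition hnorm {H : HilbertSpace} (x : H) : R := sqrt (fst (hinner x x)).

Definition linear_op {H : HilbertSpace} (T : H -> H) : Prop :=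
  (forall x y, T (hadd x y) = hadd (T x) (T y)) /\
  (forall a x, T (hscal a x) = hscal a (T x)).

Definition bounded_op {H : HilbertSpace} (T : H -> H) : Prop :=
  exists M, forall x, hnorm (T x) <= M * hnorm x.

Definition compact_op {H : HilbertSpace} (T : H -> H) : Prop :=
  forall u : nat -> H, (exists M, forall n, hnorm (u n) <= M) ->
  exists phi : nat -> nat, (forall n, (phi n < phi (S n))%nat) /\
  exists l : H, forall eps, 0 < eps -> exists N, forall n, (N <= n)%nat ->
     hnorm (hadd (T (u (phi n))) (hopp l)) < eps.

Definition positive_op {H : HilbertSpace} (R0 : H -> H) : Prop :=
  forall x, snd (hinner (R0 x) x) = 0 /\ 0 <= fst (hinner (R0 x) x).

(* R0 = (T^* T)^{1/2}: R0 bounded linear positive with R0^2 = T^*T,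
   i.e. <R0 (R0 x), y> = <T^*T x, y> = <T x, T y> for all x y. *)
Definition is_modulus {H : HilbertSpace} (T R0 : H -> H) : Prop :=
  linear_op R0 /\ bounded_op R0 /\ positive_op R0 /\
  forall x y, hinner (R0 (R0 x)) y = hinner (T x) (T y).

Fixpoint hlincomb {H : HilbertSpace} (k : nat) (c : nat -> C) (v : nat -> H) : H :=
  match k with
  | O => h0
  | Datatypes.S k' => hadd (hlincomb k' c v) (hscal (c k') (v k'))
  end.

Definition eigen_dim {H : HilbertSpace} (R0 : H -> H) (mu : R) (k : nat) : Prop :=
  exists v : nat -> H,
    (forall i, (i < k)%nat -> R0 (v i) = hscal (RtoC mu) (v i)) /\
    (forall c, hlincomb k c v = h0 -> forall i, (i < k)%nat -> c i = C0) /\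
    (forall x, R0 x = hscal (RtoC mu) x -> exists c, x = hlincomb k c v).

Definition count_eq (lam : nat -> R) (mu : R) (k : nat) : Prop :=
  exists l : list nat, NoDup l /\ length l = k /\ forall n, In n l <-> lam n = mu.

(* lam is the sequence of singular values of T: the positive eigenvalues of
   (T^*T)^{1/2}, in nonincreasing order, repeated according to multiplicity
   (padded with zeros if there are only finitely many). *)
Definition singular_values {H : HilbertSpace} (T : H -> H) (lam : nat -> R) : Prop :=
  exists R0, is_modulus T R0 /\
    (forall n, 0 <= lam n) /\ (forall n, lam (Datatypes.S n) <= lam n) /\
    forall mu, 0 < mu -> exists k, eigen_dim R0 mu k /\ count_eq lam mu k.

Definition rpow (x p : R) : R := if Rle_dec x 0 then 0 else Rpower x p.

Definition in_Schatten {H : HilbertSpace} (p : R) (T : H -> H) : Prop :=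
  compact_op T /\ exists lam, singular_values T lam /\
    exists s, Un_cv (fun N => sum_f_R0 (fun n => rpow (lam n) p) N) s.

Definition countable_type (I : Type) : Prop :=
  exists f : I -> nat, forall i j, f i = f j -> i = j.

Definition orthonormal_basis {H : HilbertSpace} (I : Type) (e : I -> H) : Prop :=
  (forall i, hinner (e i) (e i) = C1) /\
  (forall i j, i <> j -> hinner (e i) (e j) = C0) /\
  (forall x, (forall i, hinner x (e i) = C0) -> x = h0).

(* sum over I of nonnegative terms g is <= c (all finite partial sums bounded) *)
Definition sum_le {I : Type} (g : I -> R) (c : R) : Prop :=
  forall l : list I, NoDup l -> fold_right Rplus 0 (map g l) <= c.

Definition frame_bounds {H : HilbertSpace} (f : nat -> H) (C1' C2' : R) : Prop :=
  0 < C1' /\ C1' <= C2' /\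
  forall x : H, exists s,
    Un_cv (fun N => sum_f_R0 (fun n => Rsqr (Cmod (hinner x (f n)))) N) s /\
    C1' * Rsqr (hnorm x) <= s /\ s <= C2' * Rsqr (hnorm x).

Definition is_frame {H : HilbertSpace} (f : nat -> H) : Prop :=
  exists C1' C2', frame_bounds f C1' C2'.

Definition is_glb (E : R -> Prop) (b : R) : Prop :=
  (forall x, E x -> b <= x) /\ (forall b', (forall x, E x -> b' <= x) -> b' <= b).

Definition upper_frame_bound {H : HilbertSpace} (f : nat -> H) (B : R) : Prop :=
  is_glb (fun C2' => exists C1', frame_bounds f C1' C2') B.

(* Main.v *)
From Stdlib Require Import Reals List Lra Lia Classical ClassicalEpsilon.
Require Import Defs.
Open Scope R_scope.

(** Every finite orthonormal system extends to an orthonormal basis, which is also a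
    frame with upper bound 1, so both sum conditions bound the sum of |<T w_k, w_k>|^p
    over finite orthonormal systems w.  Diagonalizing the Hermitian parts of T and -iT
    on the finite-dimensional space spanned by two orthonormal systems v and u, and
    applying Jensen's inequality to the resulting substochastic matrices, bounds the
    sum of |<T v_i, u_i>|^p.  If T were not compact, one could choose v and u greedily
    with all |<T v_i, u_i>| bounded below; so T is compact, and taking for v and u its
    singular vectors bounds the sum of the p-th powers of the singular values.

    Conversely, truncate the singular value decomposition after J terms.  For a Bessel
    family f, |<T f_i, f_i>| is at most an average of s_0, ..., s_J with weights
    (|<f_i, v_k>|^2 + |<f_i, u_k>|^2) / 2 and a residual weight at s_J, and Jensen's
    inequality applies again.

    Singular vectors and eigenvectors of Hermitian forms are both obtained by
    successively maximizing a quadratic form on orthogonal complements; neither adjoint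
    operators nor uniqueness of the modulus are needed. *)


(** In the forward direction the constant must not depend on the number n of vectors tested. The
    residual weights form one extra column of a matrix with row sums at most 1, and the sum of that
    column may be as large as n; J is therefore taken so late that s_J^p < 1/(n+1), and the column
    costs at most 1.

    Condition (i) speaks of a sequence attached to some modulus of T, while the decomposition built
    here has its own numbers s_j. Every modulus has v_j as an eigenvector for s_j, so comparing
    multiplicities embeds the nonzero s_j injectively into the given sequence, and this one
    inequality suffices. For the converse a modulus is constructed, as the operator x -> sum_j s_j
    <x,v_j> v_j.

    Greedy maximization gives no information once the maximum is 0, and a Hermitian form may be
    indefinite. A multiple of the inner product is therefore added first: orthonormal vectors that
    diagonalize the sum also diagonalize the form, and the sum is coercive. *)

Local Notation "x +v y" := (hadd x y) (at level 50, left associativity).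
Local Notation "x -v y" := (hadd x (hopp y)) (at level 50, left associativity).
Local Notation "a *v x" := (hscal a x) (at level 40, left associativity).

(** * Real and imaginary parts of the inner product *)

Section InnerProduct.
Context {H : HilbertSpace}.
Implicit Types x y z : H.

(** Working with real components and squared moduli turns identities into [ring] goals after
    rewriting with [inner], and estimates into [lra] or [nra] goals free of square roots. *)
Definition re x y : R := fst (hinner x y).
Definition im x y : R := snd (hinner x y).
Definition n2 x : R := re x x.
Definition cn2 (z : C) : R := fst z ^ 2 + snd z ^ 2.
Definition ip2 x y : R := cn2 (hinner x y).

Lemma hinner_re_im x y : hinner x y = (re x y, im x y).
Proof. unfold re, im. now destruct (hinner x y). Qed.

Lemma ip2_re_im x y : ip2 x y = re x y ^ 2 + im x y ^ 2.
Proof. reflexivity. Qed.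

Lemma re_sym x y : re y x = re x y.
Proof. unfold re. rewrite (hinner_conj H x y). reflexivity. Qed.

Lemma im_sym x y : im y x = - im x y.
Proof. unfold im. rewrite (hinner_conj H x y). reflexivity. Qed.

Lemma im_self x : im x x = 0.
Proof. generalize (im_sym x x). lra. Qed.

Lemma re_add_l x y z : re (x +v y) z = re x z + re y z.
Proof. unfold re. now rewrite hinner_add_l. Qed.

Lemma im_add_l x y z : im (x +v y) z = im x z + im y z.
Proof. unfold im. now rewrite hinner_add_l. Qed.

Lemma re_add_r x y z : re z (x +v y) = re z x + re z y.
Proof. rewrite re_sym, re_add_l, (re_sym z x), (re_sym z y). reflexivity. Qed.

Lemma im_add_r x y z : im z (x +v y) = im z x + im z y.
Proof. rewrite im_sym, im_add_l, (im_sym z x), (im_sym z y). ring. Qed.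

Lemma re_0_l y : re h0 y = 0.
Proof. generalize (re_add_l h0 h0 y). rewrite hadd_0. lra. Qed.

Lemma im_0_l y : im h0 y = 0.
Proof. generalize (im_add_l h0 h0 y). rewrite hadd_0. lra. Qed.

Lemma re_0_r y : re y h0 = 0.
Proof. rewrite re_sym. apply re_0_l. Qed.

Lemma im_0_r y : im y h0 = 0.
Proof. rewrite im_sym, im_0_l. ring. Qed.

Lemma re_opp_l x y : re (hopp x) y = - re x y.
Proof. generalize (re_add_l x (hopp x) y). rewrite hadd_opp, re_0_l. lra. Qed.

Lemma im_opp_l x y : im (hopp x) y = - im x y.
Proof. generalize (im_add_l x (hopp x) y). rewrite hadd_opp, im_0_l. lra. Qed.

Lemma re_opp_r x y : re y (hopp x) = - re y x.
Proof. rewrite re_sym, re_opp_l, (re_sym y x). reflexivity. Qed.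

Lemma im_opp_r x y : im y (hopp x) = - im y x.
Proof. rewrite im_sym, im_opp_l, (im_sym y x). ring. Qed.

Lemma re_scal_l a x y : re (a *v x) y = fst a * re x y - snd a * im x y.
Proof. unfold re, im. now rewrite hinner_scal_l. Qed.

Lemma im_scal_l a x y : im (a *v x) y = fst a * im x y + snd a * re x y.
Proof. unfold re, im. now rewrite hinner_scal_l. Qed.

Lemma re_scal_r a x y : re y (a *v x) = fst a * re y x + snd a * im y x.
Proof. rewrite re_sym, re_scal_l, (re_sym y x), (im_sym y x). ring. Qed.

Lemma im_scal_r a x y : im y (a *v x) = fst a * im y x - snd a * re y x.
Proof. rewrite im_sym, im_scal_l, (re_sym y x), (im_sym y x). ring. Qed.

Lemma n2_pos x : 0 <= n2 x.
Proof. apply hinner_pos. Qed.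

Lemma n2_eq0 x : n2 x = 0 -> x = h0.
Proof.
  intros h. apply hinner_def. rewrite hinner_re_im, im_self.
  unfold n2 in h. now rewrite h.
Qed.

Lemma n2_0 : n2 (@h0 H) = 0.
Proof. apply re_0_l. Qed.

End InnerProduct.

#[local] Hint Rewrite @re_add_l @re_add_r @im_add_l @im_add_r @re_0_l @re_0_r @im_0_l
  @im_0_r @re_opp_l @re_opp_r @im_opp_l @im_opp_r @re_scal_l @re_scal_r
  @im_scal_l @im_scal_r @im_self : inner.

Ltac inner_simpl := rewrite ?ip2_re_im; unfold cn2, n2; autorewrite with inner;
  unfold RtoC, C0, C1; cbn [fst snd].

(** * Norm inequalities and convergence *)

Section Geometry.
Context {H : HilbertSpace}.
Implicit Types x y z : H.

(** Testing against z = x - y gives a squared norm, so real parts are enough. *)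
Lemma vec_ext x y : (forall z, re x z = re y z) -> x = y.
Proof.
  intros h.
  assert (e : x -v y = h0).
  { apply n2_eq0. unfold n2 at 1. rewrite re_add_l, re_opp_l, h. ring. }
  rewrite <- (hadd_0 H x), <- (hadd_opp H y), (hadd_comm H y), hadd_assoc, e.
  rewrite hadd_comm. apply hadd_0.
Qed.

Lemma ip2_pos x y : 0 <= ip2 x y.
Proof. rewrite ip2_re_im. nra. Qed.

Lemma ip2_sym x y : ip2 x y = ip2 y x.
Proof. rewrite !ip2_re_im, (re_sym y x), (im_sym y x). ring. Qed.

Lemma hinner_eq0_sym x y : hinner x y = C0 -> hinner y x = C0.
Proof.
  rewrite !hinner_re_im, (re_sym x y), (im_sym x y). intros [= h1 h2].
  rewrite h1, h2. unfold C0. f_equal. ring.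
Qed.

Lemma hinner_eq0 x y : re x y = 0 -> im x y = 0 -> hinner x y = C0.
Proof. intros h1 h2. now rewrite hinner_re_im, h1, h2. Qed.

Lemma re_eq0 x y : hinner x y = C0 -> re x y = 0.
Proof. intros h. unfold re. now rewrite h. Qed.

Lemma im_eq0 x y : hinner x y = C0 -> im x y = 0.
Proof. intros h. unfold im. now rewrite h. Qed.

Lemma cauchy_schwarz x y : ip2 x y <= n2 x * n2 y.
Proof.
  destruct (Req_dec (n2 y) 0) as [e|e].
  - rewrite (n2_eq0 y e). inner_simpl. lra.
  - assert (py : 0 < n2 y) by (generalize (n2_pos y); lra).
    generalize (n2_pos ((n2 y, 0) *v x -v hinner x y *v y)).
    rewrite (hinner_re_im x y).
    (* The vector is [n2 y] times the component of x orthogonal to y, so its squared norm carries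
       the factor [n2 y], which can be cancelled. *)
    assert (id : n2 ((n2 y, 0) *v x -v (re x y, im x y) *v y)
                 = n2 y * (n2 x * n2 y - ip2 x y)).
    { inner_simpl. rewrite (re_sym x y), (im_sym x y). ring. }
    rewrite id. intros h. nra.
Qed.

Lemma parallelogram x y : n2 (x +v y) + n2 (x -v y) = 2 * n2 x + 2 * n2 y.
Proof. inner_simpl. ring. Qed.

(** A triangle inequality for squared norms; the lossy factor 2 avoids square roots and is harmless
    in limit arguments. *)
Lemma n2_add_le x y : n2 (x +v y) <= 2 * n2 x + 2 * n2 y.
Proof. generalize (parallelogram x y) (n2_pos (x -v y)). lra. Qed.

Lemma n2_sub_sym x y : n2 (x -v y) = n2 (y -v x).
Proof. inner_simpl. ring. Qed.

Lemma n2_triangle x y z : n2 (x -v z) <= 2 * n2 (x -v y) + 2 * n2 (y -v z).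
Proof.
  replace (x -v z) with ((x -v y) +v (y -v z)); [apply n2_add_le|].
  apply vec_ext; intro w; inner_simpl; ring.
Qed.

Lemma n2_scal a x : n2 (a *v x) = cn2 a * n2 x.
Proof. inner_simpl. ring. Qed.

Lemma hnorm_sq x : Rsqr (hnorm x) = n2 x.
Proof. apply Rsqr_sqrt, n2_pos. Qed.

Lemma hnorm_lt x eps : 0 < eps -> n2 x < eps * eps -> hnorm x < eps.
Proof.
  intros h1 h2. unfold hnorm. fold (re x x). fold (n2 x).
  rewrite <- (sqrt_square eps) by lra. apply sqrt_lt_1_alt.
  split; [apply n2_pos|lra].
Qed.

Lemma n2_lt x eps : hnorm x < eps -> n2 x < eps * eps.
Proof.
  intros h. rewrite <- hnorm_sq. unfold Rsqr.
  assert (0 <= hnorm x) by apply sqrt_pos. nra.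
Qed.

Definition cauchy (u : nat -> H) := forall eps, 0 < eps -> exists N, forall m n,
  (N <= m)%nat -> (N <= n)%nat -> n2 (u m -v u n) < eps.

Definition converges (u : nat -> H) l := forall eps, 0 < eps -> exists N, forall n,
  (N <= n)%nat -> n2 (u n -v l) < eps.

Lemma cauchy_converges u : cauchy u -> exists l, converges u l.
Proof.
  intros h. destruct (hcomplete H u) as [l hl].
  - intros eps he. destruct (h (eps * eps)) as [N hN]; [nra|].
    exists N. intros m n hm hn. apply hnorm_lt; auto.
  - exists l. intros eps he.
    destruct (hl (sqrt eps)) as [N hN]; [now apply sqrt_lt_R0|].
    exists N. intros n hn. rewrite <- (sqrt_sqrt eps) by lra.
    apply n2_lt. now apply hN.
Qed.

Lemma converges_cauchy u l : converges u l -> cauchy u.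
Proof.
  intros h eps he. destruct (h (eps / 4)) as [N hN]; [lra|].
  exists N. intros m n hm hn.
  generalize (n2_triangle (u m) l (u n)) (hN m hm) (hN n hn) (n2_sub_sym l (u n)).
  lra.
Qed.

Lemma le_epsilon_mult a K : 0 <= K -> (forall d, 0 < d -> a <= K * d) -> a <= 0.
Proof.
  intros hK h. destruct (Rle_lt_dec a 0) as [l|l]; [lra|].
  assert (h1 : 0 < a / (2 * (K + 1))) by (apply Rdiv_lt_0_compat; lra).
  specialize (h _ h1).
  assert (e : (2 * (K + 1)) * (a / (2 * (K + 1))) = a) by (field; lra).
  nra.
Qed.

End Geometry.

(** * Linear and bounded operators *)

Section LinearOperators.
Context {H : HilbertSpace}.
Implicit Types (x y : H) (T : H -> H).

Lemma linear_sub T x y : linear_op T -> T (x -v y) = T x -v T y.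
Proof.
  intros [ha hs].
  assert (e : forall z : H, hopp z = (-1, 0) *v z).
  { intro z. apply vec_ext; intro w; inner_simpl; ring. }
  now rewrite ha, !e, hs.
Qed.

Lemma linear_0 T : linear_op T -> T h0 = h0.
Proof.
  intros h. rewrite <- (hadd_opp H h0), linear_sub by easy. now rewrite !hadd_opp.
Qed.

Lemma bounded_n2 T : bounded_op T -> exists K, 0 <= K /\ forall x, n2 (T x) <= K * n2 x.
Proof.
  intros [M hM]. exists (M * M). split; [nra|]. intros x.
  rewrite <- !hnorm_sq. unfold Rsqr.
  assert (0 <= hnorm (T x)) by apply sqrt_pos. specialize (hM x). nra.
Qed.

End LinearOperators.

(** * Finite real sums *)

Fixpoint rsum (n : nat) (f : nat -> R) : R :=
  match n with O => 0 | S k => rsum k f + f k end.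

Lemma rsum_ext n f g : (forall i, (i < n)%nat -> f i = g i) -> rsum n f = rsum n g.
Proof. induction n; simpl; intros h; [easy|]. rewrite IHn, h; auto. Qed.

Lemma rsum_le n f g : (forall i, (i < n)%nat -> f i <= g i) -> rsum n f <= rsum n g.
Proof. induction n; simpl; intros h; [lra|]. apply Rplus_le_compat; auto. Qed.

Lemma rsum_const n c : rsum n (fun _ => c) = INR n * c.
Proof. induction n; [simpl; ring|]. rewrite S_INR. simpl. rewrite IHn. ring. Qed.

Lemma rsum_plus n f g : rsum n (fun i => f i + g i) = rsum n f + rsum n g.
Proof. induction n; simpl; [ring|]. rewrite IHn. ring. Qed.

Lemma rsum_minus n f g : rsum n (fun i => f i - g i) = rsum n f - rsum n g.
Proof. induction n; simpl; [ring|]. rewrite IHn. ring. Qed.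

Lemma rsum_scal n c f : rsum n (fun i => c * f i) = c * rsum n f.
Proof. induction n; simpl; [ring|]. rewrite IHn. ring. Qed.

Lemma rsum_pos n f : (forall i, (i < n)%nat -> 0 <= f i) -> 0 <= rsum n f.
Proof.
  intros h. replace 0 with (rsum n (fun _ => 0)) by (rewrite rsum_const; ring).
  now apply rsum_le.
Qed.

Lemma rsum_mono n m f : (n <= m)%nat -> (forall i, 0 <= f i) -> rsum n f <= rsum m f.
Proof. intros h p. induction h; simpl; [lra|]. specialize (p m). lra. Qed.

Lemma rsum_ge_term n f i : (i < n)%nat -> (forall j, 0 <= f j) -> f i <= rsum n f.
Proof.
  intros h p. apply Rle_trans with (rsum (S i) f).
  - simpl. generalize (rsum_pos i f (fun j _ => p j)). lra.
  - apply rsum_mono; auto.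
Qed.

Lemma rsum_swap n m f :
  rsum n (fun i => rsum m (f i)) = rsum m (fun j => rsum n (fun i => f i j)).
Proof.
  induction n; simpl.
  - rewrite rsum_const. ring.
  - rewrite IHn, rsum_plus. reflexivity.
Qed.

Lemma sum_f_R0_rsum f n : sum_f_R0 f n = rsum (S n) f.
Proof. induction n; simpl in *; [ring|]. now rewrite IHn. Qed.

(** * Choice of a sequence with conditions on its past *)

Section DependentSequence.
Context {A : Type} (a0 : A) (Q : nat -> (nat -> A) -> A -> Prop).
Hypothesis Q_ext : forall n s s' a,
  (forall i, (i < n)%nat -> s i = s' i) -> Q n s a -> Q n s' a.
Hypothesis Q_ex : forall n s, exists a, Q n s a.

Let next n s : A := proj1_sig (constructive_indefinite_description _ (Q_ex n s)).

(** Only the entries of [prefix n] below [n] are meaningful; the later ones repeat the last choice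
    as filler. *)
Fixpoint prefix (n : nat) : nat -> A :=
  match n with
  | O => fun _ => a0
  | S k => fun i => if Nat.ltb i k then prefix k i else next k (prefix k)
  end.

Lemma prefix_stable n i : (i < n)%nat -> prefix n i = next i (prefix i).
Proof.
  revert i. induction n; intros i h; [lia|]. simpl.
  destruct (Nat.ltb_spec i n).
  - now apply IHn.
  - now replace i with n by lia.
Qed.

(** [Q_ext] says that the condition on the n-th term sees only earlier terms. Gram-Schmidt, greedy
    maximization and diagonal extraction are all instances. *)
Lemma dependent_sequence : exists s, forall n, Q n s (s n).
Proof.
  exists (fun n => next n (prefix n)). intros n.
  apply Q_ext with (prefix n); [intros; now apply prefix_stable|].
  exact (proj2_sig (constructive_indefinite_description _ (Q_ex n (prefix n)))).
Qed.
End DependentSequence.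

(** * Orthonormal systems, projections and Gram-Schmidt *)

Section Orthonormal.
Context {H : HilbertSpace}.
Implicit Types (x y z : H) (e g w : nat -> H).

(* Zero vectors are allowed, so that finite systems and Gram-Schmidt
   families of dependent vectors are still indexed by [nat]. *)
Definition orthonormal0 e :=
  (forall i j, i <> j -> hinner (e i) (e j) = C0) /\
  (forall i, e i = h0 \/ n2 (e i) = 1).

Definition proj n e x : H := hlincomb n (fun i => hinner x (e i)) e.

Lemma re_lincomb_l n c (v : nat -> H) z : re (hlincomb n c v) z
  = rsum n (fun i => fst (c i) * re (v i) z - snd (c i) * im (v i) z).
Proof. induction n; simpl; autorewrite with inner; [easy|]. now rewrite IHn. Qed.

Lemma im_lincomb_l n c (v : nat -> H) z : im (hlincomb n c v) z
  = rsum n (fun i => fst (c i) * im (v i) z + snd (c i) * re (v i) z).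
Proof. induction n; simpl; autorewrite with inner; [easy|]. now rewrite IHn. Qed.

Lemma lincomb_orth n c (v : nat -> H) z :
  (forall i, (i < n)%nat -> hinner (v i) z = C0) -> hinner (hlincomb n c v) z = C0.
Proof.
  intros h. apply hinner_eq0; [rewrite re_lincomb_l|rewrite im_lincomb_l];
  rewrite (rsum_ext _ _ (fun _ => 0)); rewrite ?rsum_const; try ring;
  intros i hi; rewrite (re_eq0 _ _ (h i hi)), (im_eq0 _ _ (h i hi)); ring.
Qed.

Lemma linear_lincomb (T : H -> H) n c v : linear_op T ->
  T (hlincomb n c v) = hlincomb n c (fun i => T (v i)).
Proof.
  intros hT. induction n; simpl; [now apply linear_0|].
  destruct hT as [ha hs]. now rewrite ha, hs, IHn.
Qed.

Lemma lincomb_ext n c c' (v v' : nat -> H) :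
  (forall i, (i < n)%nat -> c i = c' i /\ v i = v' i) ->
  hlincomb n c v = hlincomb n c' v'.
Proof.
  induction n; intros h; simpl; [easy|].
  destruct (h n) as [-> ->]; [lia|]. rewrite IHn; auto.
Qed.

Lemma ons_n2_le1 e i : orthonormal0 e -> n2 (e i) <= 1.
Proof. intros [_ h]. destruct (h i) as [->| ->]; rewrite ?n2_0; lra. Qed.

Lemma ons_unit e i : orthonormal0 e -> e i <> h0 -> n2 (e i) = 1.
Proof. intros [_ h] hi. destruct (h i); easy. Qed.

(** The factor [n2 (e i)] is 1, or else the inner product is 0; this removes case distinctions on
    zero vectors. *)
Lemma ons_inner_n2 e x i : orthonormal0 e ->
  re x (e i) * n2 (e i) = re x (e i) /\ im x (e i) * n2 (e i) = im x (e i).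
Proof.
  intros [_ h]. destruct (h i) as [->| ->]; autorewrite with inner; lra.
Qed.

Lemma inner_lincomb_ons n c e j : orthonormal0 e ->
  re (hlincomb n c e) (e j) = (if Nat.ltb j n then fst (c j) * n2 (e j) else 0) /\
  im (hlincomb n c e) (e j) = (if Nat.ltb j n then snd (c j) * n2 (e j) else 0).
Proof.
  intros h. induction n; simpl hlincomb.
  - autorewrite with inner. destruct (Nat.ltb_spec j 0); [lia|easy].
  - autorewrite with inner. destruct IHn as [-> ->].
    destruct (Nat.eq_dec n j) as [->|ne].
    + rewrite im_self. fold (n2 (e j)).
      destruct (Nat.ltb_spec j j); [lia|].
      destruct (Nat.ltb_spec j (S j)); [|lia]. split; ring.
    + rewrite (re_eq0 _ _ (proj1 h n j ne)), (im_eq0 _ _ (proj1 h n j ne)).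
      destruct (Nat.ltb_spec j n), (Nat.ltb_spec j (S n)); try lia; split; ring.
Qed.

Lemma lincomb_inner_ons n c e j : orthonormal0 e -> (j < n)%nat -> e j <> h0 ->
  hinner (hlincomb n c e) (e j) = c j.
Proof.
  intros h hj hne. rewrite hinner_re_im.
  destruct (inner_lincomb_ons n c e j h) as [-> ->].
  destruct (Nat.ltb_spec j n); [|lia].
  rewrite (ons_unit e j h hne), !Rmult_1_r. now destruct (c j).
Qed.

Lemma proj_inner n e x j : orthonormal0 e -> (j < n)%nat ->
  hinner (proj n e x) (e j) = hinner x (e j).
Proof.
  intros h hj. rewrite (hinner_re_im (proj n e x)), (hinner_re_im x).
  unfold proj. destruct (inner_lincomb_ons n (fun i => hinner x (e i)) e j h) as [-> ->].
  destruct (Nat.ltb_spec j n); [|lia].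
  destruct (ons_inner_n2 e x j h). now f_equal.
Qed.

Lemma residual_orth n e x j : orthonormal0 e -> (j < n)%nat ->
  hinner (x -v proj n e x) (e j) = C0.
Proof.
  intros h hj. assert (p := proj_inner n e x j h hj). rewrite !hinner_re_im in p.
  injection p as p1 p2. apply hinner_eq0; autorewrite with inner; lra.
Qed.

Lemma n2_lincomb_ons n c e : orthonormal0 e ->
  n2 (hlincomb n c e) = rsum n (fun i => cn2 (c i) * n2 (e i)).
Proof.
  intros h. induction n; simpl hlincomb; [apply n2_0|]. simpl rsum. rewrite <- IHn.
  destruct (inner_lincomb_ons n c e n h) as [h1 h2].
  destruct (Nat.ltb_spec n n); [lia|].
  unfold n2 at 1. autorewrite with inner.
  rewrite (re_sym (hlincomb n c e) (e n)), (im_sym (hlincomb n c e) (e n)), h1, h2.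
  inner_simpl. ring.
Qed.

Lemma n2_proj n e x : orthonormal0 e -> n2 (proj n e x) = rsum n (fun i => ip2 x (e i)).
Proof.
  intros h. unfold proj. rewrite n2_lincomb_ons by easy. apply rsum_ext. intros i _.
  destruct (ons_inner_n2 e x i h) as [h1 h2].
  fold (ip2 x (e i)). rewrite ip2_re_im.
  replace ((re x (e i) ^ 2 + im x (e i) ^ 2) * n2 (e i)) with
    (re x (e i) * (re x (e i) * n2 (e i)) + im x (e i) * (im x (e i) * n2 (e i))) by ring.
  rewrite h1, h2. ring.
Qed.

Lemma n2_residual n e x : orthonormal0 e ->
  n2 (x -v proj n e x) = n2 x - rsum n (fun i => ip2 x (e i)).
Proof.
  intros h. rewrite <- n2_proj by easy.
  assert (o : hinner (x -v proj n e x) (proj n e x) = C0).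
  { apply hinner_eq0_sym. unfold proj at 1. apply lincomb_orth. intros i hi.
    apply hinner_eq0_sym, residual_orth; easy. }
  apply re_eq0 in o. revert o. inner_simpl. rewrite (re_sym x (proj n e x)). lra.
Qed.

Lemma bessel n e x : orthonormal0 e -> rsum n (fun i => ip2 x (e i)) <= n2 x.
Proof.
  intros h. generalize (n2_residual n e x h) (n2_pos (x -v proj n e x)). lra.
Qed.

(** The span is encoded as a double orthogonal complement: no coefficients are carried, and
    stability under combinations and limits is immediate. *)
Definition in_span n g x :=
  forall z, (forall i, (i < n)%nat -> hinner z (g i) = C0) -> hinner x z = C0.

(** The residual is orthogonal to all g_i, hence to x and to the projection, hence to itself. *)
Lemma in_span_proj n g x : orthonormal0 g -> in_span n g x -> x = proj n g x.
Proof.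
  intros h hx. set (r := x -v proj n g x).
  assert (hr : forall i, (i < n)%nat -> hinner r (g i) = C0)
    by (intros; now apply residual_orth).
  assert (r0 : r = h0).
  { apply n2_eq0. unfold n2, r at 1. rewrite re_add_l, re_opp_l.
    rewrite (re_eq0 _ _ (hx r hr)). unfold proj.
    rewrite (re_eq0 (hlincomb _ _ _) r); [ring|]. apply lincomb_orth.
    intros; now apply hinner_eq0_sym, hr. }
  apply vec_ext. intros z. assert (e : re r z = 0) by (rewrite r0; apply re_0_l).
  unfold r in e. rewrite re_add_l, re_opp_l in e. lra.
Qed.

Lemma in_span_mono n m g x : (n <= m)%nat -> in_span n g x -> in_span m g x.
Proof. intros l h z hz. apply h. intros. apply hz. lia. Qed.

Lemma in_span_lincomb n g k c v :
  (forall i, (i < k)%nat -> in_span n g (v i)) -> in_span n g (hlincomb k c v).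
Proof. intros h z hz. apply lincomb_orth. intros. now apply h. Qed.

(* Summing |<w_k, g_i>|^2 in both orders replaces dimension counting. *)
Lemma trace_le m w n g : orthonormal0 w -> orthonormal0 g ->
  (forall k, (k < m)%nat -> in_span n g (w k)) ->
  rsum m (fun k => n2 (w k)) <= INR n.
Proof.
  intros hw hg h.
  rewrite (rsum_ext m _ (fun k => rsum n (fun i => ip2 (w k) (g i)))).
  - rewrite rsum_swap, <- (Rmult_1_r (INR n)), <- rsum_const. apply rsum_le.
    intros i _. apply Rle_trans with (n2 (g i)); [|now apply ons_n2_le1].
    rewrite (rsum_ext m _ (fun k => ip2 (g i) (w k))); [now apply bessel|].
    intros; apply ip2_sym.
  - intros k hk. rewrite (in_span_proj n g (w k)) at 1 by auto. now apply n2_proj.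
Qed.

Definition normalize x : H :=
  if Req_EM_T (n2 x) 0 then h0 else (/ sqrt (n2 x), 0) *v x.

Lemma normalize_cases x : normalize x = h0 \/ n2 (normalize x) = 1.
Proof.
  unfold normalize. destruct (Req_EM_T (n2 x) 0) as [h|h]; [now left|right].
  assert (p := n2_pos x). assert (q := sqrt_lt_R0 (n2 x)).
  rewrite n2_scal. unfold cn2; simpl fst; simpl snd.
  rewrite <- (sqrt_sqrt (n2 x)) at 2 by easy. field. lra.
Qed.

Lemma normalize_scal x : x = (sqrt (n2 x), 0) *v normalize x.
Proof.
  unfold normalize. destruct (Req_EM_T (n2 x) 0) as [h|h].
  - rewrite (n2_eq0 x h). apply vec_ext; intro; inner_simpl; ring.
  - assert (p := n2_pos x). assert (q := sqrt_lt_R0 (n2 x)).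
    apply vec_ext; intro z. inner_simpl. field. unfold n2 in *. lra.
Qed.

Lemma normalize_orth x z : hinner x z = C0 -> hinner (normalize x) z = C0.
Proof.
  intros h. unfold normalize. destruct (Req_EM_T (n2 x) 0).
  - apply hinner_eq0; now autorewrite with inner.
  - apply re_eq0 in h as h1. apply im_eq0 in h as h2.
    apply hinner_eq0; autorewrite with inner; rewrite h1, h2; ring.
Qed.

Lemma normalize_id x : x = h0 \/ n2 x = 1 -> normalize x = x.
Proof.
  intros h. unfold normalize. destruct (Req_EM_T (n2 x) 0) as [e|e].
  - symmetry. now apply n2_eq0.
  - destruct h as [->| ->]; [now destruct e; apply n2_0|].
    apply vec_ext; intro z. inner_simpl. rewrite sqrt_1. field.
Qed.

(** The recursion is part of the conclusion because [ons_extend] uses it to see that an initial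
    orthonormal segment is left unchanged. *)
Lemma gram_schmidt (d : nat -> H) : exists g, orthonormal0 g /\
  (forall n, in_span (S n) g (d n)) /\
  (forall n, g n = normalize (d n -v proj n g (d n))).
Proof.
  destruct (dependent_sequence h0 (fun n s a => a = normalize (d n -v proj n s (d n))))
    as [g hg].
  - intros n s s' a hs ->. do 3 f_equal. apply lincomb_ext.
    intros i hi. now rewrite hs.
  - intros n s. now eexists.
  - exists g.
    assert (o : forall n i, (i < n)%nat -> hinner (g n) (g i) = C0).
    { induction n as [n IH] using (well_founded_induction Nat.lt_wf_0). intros i hi. rewrite (hg n).
      apply normalize_orth.
      (* Only the first n vectors are known to be orthonormal at this point. *)
      set (g' := fun j => if Nat.ltb j n then g j else h0).
      assert (hg' : orthonormal0 g').
      { split.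
        - intros j k hjk. unfold g'.
          destruct (Nat.ltb_spec j n), (Nat.ltb_spec k n);
            try (apply hinner_eq0; now autorewrite with inner).
          destruct (Nat.lt_total j k) as [l|[l|l]]; [|easy|now apply IH].
          apply hinner_eq0_sym. now apply IH.
        - intros j. unfold g'. destruct (Nat.ltb_spec j n); [|now left].
          rewrite hg. apply normalize_cases. }
      assert (e : proj n g (d n) = proj n g' (d n)).
      { apply lincomb_ext. intros j hj. unfold g'.
        destruct (Nat.ltb_spec j n); [easy|lia]. }
      rewrite e. assert (ei : g i = g' i)
        by (unfold g'; destruct (Nat.ltb_spec i n); [easy|lia]).
      rewrite ei. now apply residual_orth. }
    split; [|split; [|easy]].
    + split.
      * intros i j hij. destruct (Nat.lt_total i j) as [l|[l|l]]; [|easy|now apply o].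
        now apply hinner_eq0_sym, o.
      * intros i. rewrite hg. apply normalize_cases.
    + intros n z hz. set (r := d n -v proj n g (d n)).
      assert (hp : hinner (proj n g (d n)) z = C0).
      { apply lincomb_orth. intros i hi. apply hinner_eq0_sym, hz. lia. }
      assert (hr : hinner (g n) z = C0) by (apply hinner_eq0_sym, hz; lia).
      rewrite hg in hr. fold r in hr.
      apply re_eq0 in hr as h1. apply im_eq0 in hr as h2.
      apply re_eq0 in hp as h3. apply im_eq0 in hp as h4.
      assert (e1 : re r z = 0) by
        (rewrite (normalize_scal r); autorewrite with inner; rewrite h1, h2; ring).
      assert (e2 : im r z = 0) by
        (rewrite (normalize_scal r); autorewrite with inner; rewrite h1, h2; ring).
      unfold r in e1, e2. autorewrite with inner in e1, e2.
      apply hinner_eq0; lra.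
Qed.

(** Gram-Schmidt is run on the first n vectors of w followed by a dense sequence. Completeness is
    recorded as the missing half of Parseval's identity, which yields both a basis and a frame. *)
Lemma ons_extend w n : orthonormal0 w -> exists e, orthonormal0 e /\
  (forall i, (i < n)%nat -> e i = w i) /\
  (forall x eps, 0 < eps -> exists N, forall m, (N <= m)%nat ->
     n2 x - eps < rsum m (fun i => ip2 x (e i))).
Proof.
  intros hw. destruct (hseparable H) as [d hd].
  destruct (gram_schmidt (fun i => if Nat.ltb i n then w i else d (i - n)%nat))
    as [e [he [hs hn]]].
  exists e. split; [easy|]. split.
  - induction i as [i IH] using (well_founded_induction Nat.lt_wf_0). intros hi. rewrite hn.
    destruct (Nat.ltb_spec i n); [|lia].
    assert (p : proj i e (w i) = h0).
    { apply vec_ext. intros z. unfold proj. rewrite re_lincomb_l, re_0_l.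
      rewrite (rsum_ext _ _ (fun _ => 0)); [rewrite rsum_const; ring|].
      intros j hj. rewrite IH by lia.
      rewrite (proj1 hw i j) by lia. unfold C0; simpl. ring. }
    rewrite p. replace (w i -v h0) with (w i).
    + apply normalize_id, hw.
    + apply vec_ext; intro; inner_simpl; ring.
  - intros x eps heps. destruct (hd x (sqrt eps)) as [k hk]; [now apply sqrt_lt_R0|].
    exists (S (n + k)). intros m hm.
    (* The dense vector d_k sits at position n + k, so the first n + k + 1 vectors span it and the
       projection fixes it. *)
    assert (hdk : d k = proj m e (d k)).
    { apply in_span_proj; [easy|]. apply in_span_mono with (S (n + k)); [easy|].
      generalize (hs (n + k)%nat). destruct (Nat.ltb_spec (n + k) n); [lia|].
      now replace (n + k - n)%nat with k by lia. }
    (* Best approximation: x and x - d_k have the same residual. *)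
    assert (b : n2 (x -v proj m e x) <= n2 (x -v d k)).
    { replace (x -v proj m e x) with ((x -v d k) -v proj m e (x -v d k)).
      - rewrite n2_residual by easy.
        assert (0 <= rsum m (fun i => ip2 (x -v d k) (e i)))
          by (apply rsum_pos; intros; apply ip2_pos).
        lra.
      - apply vec_ext; intro z.
        assert (hz : re (d k) z = re (proj m e (d k)) z) by now rewrite <- hdk.
        assert (lin : re (proj m e (x -v d k)) z = re (proj m e x) z - re (proj m e (d k)) z).
        { unfold proj. rewrite !re_lincomb_l, <- rsum_minus. apply rsum_ext. intros i _.
          fold (re (x -v d k) (e i)) (im (x -v d k) (e i)) (re x (e i)) (im x (e i))
            (re (d k) (e i)) (im (d k) (e i)).
          autorewrite with inner. ring. }
        autorewrite with inner. rewrite lin, hz. ring. }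
    rewrite n2_residual in b by easy.
    assert (n2 (x -v d k) < sqrt eps * sqrt eps) by (now apply n2_lt).
    rewrite sqrt_sqrt in * by lra. lra.
Qed.

End Orthonormal.

(** * Powers, Jensen's inequality and substochastic matrices *)

Section Powers.
Variable p : R.
Hypothesis p_ge1 : 1 <= p.

Lemma rpow_pos x : 0 <= rpow x p.
Proof.
  unfold rpow. destruct (Rle_dec x 0); [lra|]. left. apply exp_pos.
Qed.

Lemma rpow_0 : rpow 0 p = 0.
Proof. unfold rpow. destruct (Rle_dec 0 0); lra. Qed.

Lemma rpow_gt0 x : 0 < x -> 0 < rpow x p.
Proof. intros h. unfold rpow. destruct (Rle_dec x 0); [lra|]. apply exp_pos. Qed.

Lemma rpow_mono x y : x <= y -> rpow x p <= rpow y p.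
Proof.
  intros h. unfold rpow. destruct (Rle_dec x 0), (Rle_dec y 0); try lra.
  - left. apply exp_pos.
  - apply Rle_Rpower_l; lra.
Qed.

Lemma rpow_mult a x : 0 < a -> rpow (a * x) p = rpow a p * rpow x p.
Proof.
  intros h. unfold rpow. destruct (Rle_dec a 0); [lra|].
  destruct (Rle_dec (a * x) 0), (Rle_dec x 0).
  - ring.
  - exfalso. apply n0. nra.
  - exfalso. apply n0. nra.
  - symmetry. apply Rpower_mult_distr; lra.
Qed.

Lemma ln_le_minus1 y : 0 < y -> ln y <= y - 1.
Proof.
  intros h. generalize (exp_ineq1_le (ln y)). rewrite exp_ln by easy. lra.
Qed.

(* [x] is the convex combination [y/p + (1-1/p)] with [y = 1 + p(x-1)], and [ln] is concave. *)
Lemma bernoulli x : 0 < x -> 1 + p * (x - 1) <= rpow x p.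
Proof.
  intros h. set (y := 1 + p * (x - 1)).
  destruct (Rle_lt_dec y 0) as [hy|hy]; [generalize (rpow_pos x); lra|].
  unfold rpow. destruct (Rle_dec x 0); [lra|]. unfold Rpower.
  rewrite <- (exp_ln y) by easy.
  assert (le : ln y <= p * ln x).
  { assert (h1 := ln_le_minus1 (y / x) (Rdiv_lt_0_compat _ _ hy h)).
    assert (h2 := ln_le_minus1 (/ x) (Rinv_0_lt_compat _ h)).
    unfold Rdiv in h1. rewrite ln_mult in h1 by (auto using Rinv_0_lt_compat).
    rewrite ln_Rinv in h1, h2 by easy.
    assert (id : (y * / x - 1) + (p - 1) * (/ x - 1) = 0) by (unfold y; field; lra).
    nra. }
  destruct (Rle_lt_or_eq_dec _ _ le) as [l|l]; [left; now apply exp_increasing|].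
  rewrite l. lra.
Qed.

(** The graph of x^p lies above its tangent at t: this is [bernoulli] at a/t, rescaled by
    homogeneity. *)
Lemma rpow_tangent a t : 0 <= a -> 0 < t ->
  rpow t p * (1 + p * (a / t - 1)) <= rpow a p.
Proof.
  intros ha ht. assert (hp := rpow_gt0 t ht).
  destruct (Req_dec a 0) as [->|ne].
  - rewrite rpow_0. unfold Rdiv. rewrite Rmult_0_l. nra.
  - replace (rpow a p) with (rpow (t * (a / t)) p) by (f_equal; field; lra).
    rewrite rpow_mult by easy. apply Rmult_le_compat_l; [lra|].
    apply bernoulli, Rdiv_lt_0_compat; lra.
Qed.

(** Sum the tangent inequalities at the weighted mean t. Total weight below 1 is allowed, as the
    missing mass may be thought of as placed at 0. *)
Lemma jensen n w a : (forall k, (k < n)%nat -> 0 <= w k /\ 0 <= a k) ->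
  rsum n w <= 1 ->
  rpow (rsum n (fun k => w k * a k)) p <= rsum n (fun k => w k * rpow (a k) p).
Proof.
  intros h hw. set (t := rsum n (fun k => w k * a k)).
  assert (r0 : 0 <= rsum n (fun k => w k * rpow (a k) p)).
  { apply rsum_pos. intros k hk. apply Rmult_le_pos; [now apply h|apply rpow_pos]. }
  destruct (Rle_lt_dec t 0) as [ht|ht].
  - unfold rpow at 1. now destruct (Rle_dec t 0).
  - apply Rle_trans with (rsum n (fun k => w k * (rpow t p * (1 + p * (a k / t - 1))))).
    + rewrite (rsum_ext _ _ (fun k => (rpow t p * (1 - p)) * w k
          + (rpow t p * p / t) * (w k * a k))) by (intros; field; lra).
      rewrite rsum_plus, !rsum_scal. fold t.
      replace (rpow t p * p / t * t) with (rpow t p * p) by (field; lra).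
      assert (hp := rpow_gt0 t ht).
      (* The weight deficit enters with the factor p - 1 and so has the right sign. *)
      assert (0 <= rpow t p * ((p - 1) * (1 - rsum n w))) by
        (apply Rmult_le_pos; [lra|]; apply Rmult_le_pos; lra).
      lra.
    + apply rsum_le. intros k hk. apply Rmult_le_compat_l; [now apply h|].
      apply rpow_tangent; [now apply h|easy].
Qed.

(** Row sums at most 1 permit Jensen in each row; exchanging the sums then leaves the column sums.
    The bounds [c k] may exceed 1, which the residual column of a truncated decomposition
    requires. *)
Lemma substochastic_power_sum n m (b : nat -> R) (w : nat -> nat -> R) (a c : nat -> R) :
  (forall k, (k < m)%nat -> 0 <= a k) ->
  (forall i k, (i < n)%nat -> (k < m)%nat -> 0 <= w i k) ->
  (forall i, (i < n)%nat -> rsum m (w i) <= 1) ->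
  (forall k, (k < m)%nat -> rsum n (fun i => w i k) <= c k) ->
  (forall i, (i < n)%nat -> b i <= rsum m (fun k => w i k * a k)) ->
  rsum n (fun i => rpow (b i) p) <= rsum m (fun k => c k * rpow (a k) p).
Proof.
  intros ha hw hrow hcol hb.
  apply Rle_trans with (rsum n (fun i => rsum m (fun k => w i k * rpow (a k) p))).
  - apply rsum_le. intros i hi. eapply Rle_trans; [apply rpow_mono, hb, hi|].
    apply jensen; [intros k hk; split; auto|auto].
  - rewrite rsum_swap. apply rsum_le. intros k hk.
    rewrite (rsum_ext _ _ (fun i => rpow (a k) p * w i k)) by (intros; ring).
    rewrite rsum_scal, Rmult_comm. apply Rmult_le_compat_r; [apply rpow_pos|auto].
Qed.

(** Bounds a + b by twice the larger term. *)
Lemma rpow_add a b : 0 <= a -> 0 <= b -> rpow (a + b) p <= rpow 2 p * (rpow a p + rpow b p).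
Proof.
  intros ha hb. assert (h2 := rpow_pos 2).
  assert (hpa := rpow_pos a). assert (hpb := rpow_pos b).
  destruct (Rle_lt_dec a b).
  - apply Rle_trans with (rpow (2 * b) p); [apply rpow_mono; lra|].
    rewrite rpow_mult by lra. nra.
  - apply Rle_trans with (rpow (2 * a) p); [apply rpow_mono; lra|].
    rewrite rpow_mult by lra. nra.
Qed.

End Powers.

Lemma noninc_le (lam : nat -> R) i j : (forall n, lam (S n) <= lam n) ->
  (i <= j)%nat -> lam j <= lam i.
Proof. intros h l. induction l; [lra|]. specialize (h m). lra. Qed.

(** If the n-th term were at least eps, so would be the n terms before it, and n eps > B is
    excluded. *)
Lemma summable_rpow_small p lam B : 1 <= p ->
  (forall n, lam (S n) <= lam n) ->
  (forall n, rsum n (fun i => rpow (lam i) p) <= B) ->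
  forall eps, 0 < eps -> exists N, forall n, (N <= n)%nat -> rpow (lam n) p < eps.
Proof.
  intros hp hd hB eps he. destruct (INR_unbounded (B / eps)) as [N hN].
  exists N. intros n hn. apply Rnot_le_lt. intros hc.
  assert (h : rsum n (fun _ => eps) <= rsum n (fun i => rpow (lam i) p)).
  { apply rsum_le. intros i hi. eapply Rle_trans; [exact hc|].
    apply rpow_mono; [easy|]. apply noninc_le; [easy|lia]. }
  rewrite rsum_const in h. specialize (hB n). apply le_INR in hn.
  assert (e : B / eps * eps = B) by (field; lra). nra.
Qed.

Lemma summable_small p lam B : 1 <= p ->
  (forall n, lam (S n) <= lam n) ->
  (forall n, rsum n (fun i => rpow (lam i) p) <= B) ->
  forall eps, 0 < eps -> exists N, forall n, (N <= n)%nat -> lam n < eps.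
Proof.
  intros hp hd hB eps he.
  destruct (summable_rpow_small p lam B hp hd hB (rpow eps p)) as [N hN];
    [now apply rpow_gt0|].
  exists N. intros n hn. apply Rnot_le_lt. intros hc.
  apply (Rlt_irrefl (rpow eps p)). eapply Rle_lt_trans; [|apply (hN n hn)].
  now apply rpow_mono.
Qed.

(** * Infinite index sets and precompact sequences *)

Definition infinite (P : nat -> Prop) := forall N, exists n, (N <= n)%nat /\ P n.

Lemma infinite_split (P A B : nat -> Prop) : infinite P ->
  (forall n, P n -> A n \/ B n) ->
  infinite (fun n => P n /\ A n) \/ infinite (fun n => P n /\ B n).
Proof.
  intros hP hAB. destruct (classic (infinite (fun n => P n /\ A n))) as [h|h]; [now left|].
  right. apply not_all_ex_not in h as [N hN]. intros M.
  destruct (hP (N + M)%nat) as [n [hn pn]]. exists n. split; [lia|]. split; [easy|].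
  destruct (hAB n pn) as [a|b]; [|easy]. destruct hN. exists n. split; [lia|easy].
Qed.

Lemma real_pigeonhole (a : nat -> R) B eps P : 0 < eps -> (forall n, Rabs (a n) <= B) ->
  infinite P -> exists P', infinite P' /\ (forall n, P' n -> P n) /\
    forall i j, P' i -> P' j -> Rabs (a i - a j) <= eps.
Proof.
  intros he hB hP.
  (* Induction on the number L of intervals of length eps needed to cover the values: either
     infinitely many values lie in the first interval, or it is discarded. *)
  assert (ind : forall L l (P0 : nat -> Prop), infinite P0 -> (forall n, P0 n -> P n) ->
    (forall n, P0 n -> l <= a n <= l + INR L * eps) ->
    exists P', infinite P' /\ (forall n, P' n -> P n) /\
    forall i j, P' i -> P' j -> Rabs (a i - a j) <= eps).
  { induction L; intros l P0 hi hs hb.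
    - exists P0. split; [easy|]. split; [easy|]. intros i j pi pj.
      assert (h1 := hb i pi). assert (h2 := hb j pj). simpl in *.
      apply Rabs_le. lra.
    - rewrite S_INR in hb.
      destruct (infinite_split P0 (fun n => a n <= l + eps) (fun n => l + eps <= a n) hi)
        as [h|h].
      + intros n _. lra.
      + exists (fun n => P0 n /\ a n <= l + eps). split; [easy|].
        split; [intros n [p _]; auto|]. intros i j [pi hi'] [pj hj'].
        assert (h1 := hb i pi). assert (h2 := hb j pj). apply Rabs_le. lra.
      + apply (IHL (l + eps) _ h); [intros n [p _]; auto|]. intros n [p1 p2].
        assert (h1 := hb n p1). lra. }
  destruct (INR_unbounded (2 * B / eps)) as [L hL].
  apply (ind L (- B) P); [easy|easy|]. intros n _.
  assert (hn := hB n). assert (h1 := Rle_abs (a n)). assert (h2 := Rle_abs (- a n)).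
  rewrite Rabs_Ropp in h2.
  assert (e : 2 * B / eps * eps = 2 * B) by (field; lra). nra.
Qed.

Section Precompact.
Context {H : HilbertSpace}.
Implicit Types u w : nat -> H.

(** Total boundedness phrased on index sets: every infinite set of indices can be thinned to an
    infinite one of small diameter. This form passes to sums and to uniform approximation without
    extracting subsequences. *)
Definition precompact u := forall P, infinite P -> forall eps, 0 < eps ->
  exists P', infinite P' /\ (forall n, P' n -> P n) /\
    forall k l, P' k -> P' l -> n2 (u k -v u l) <= eps.

Lemma precompact_add u w : precompact u -> precompact w ->
  precompact (fun k => u k +v w k).
Proof.
  intros hu hw P hP eps he.
  destruct (hu P hP (eps / 4)) as [P1 [i1 [s1 c1]]]; [lra|].
  destruct (hw P1 i1 (eps / 4)) as [P2 [i2 [s2 c2]]]; [lra|].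
  exists P2. split; [easy|]. split; [auto|]. intros k l hk hl.
  replace (u k +v w k -v (u l +v w l)) with ((u k -v u l) +v (w k -v w l)).
  - generalize (n2_add_le (u k -v u l) (w k -v w l)) (c1 k l (s2 _ hk) (s2 _ hl))
      (c2 k l hk hl). lra.
  - apply vec_ext; intro; inner_simpl; ring.
Qed.

Lemma precompact_scal (c : nat -> C) (v : H) B : (forall k, cn2 (c k) <= B) ->
  precompact (fun k => c k *v v).
Proof.
  intros hB P hP eps he. assert (hv := n2_pos v).
  set (d := eps / (2 * (n2 v + 1))).
  assert (hd : 0 < d) by (apply Rdiv_lt_0_compat; lra).
  assert (hb : forall k, Rabs (fst (c k)) <= sqrt B /\ Rabs (snd (c k)) <= sqrt B).
  { intros k. specialize (hB k). unfold cn2 in hB.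
    split; rewrite <- sqrt_Rsqr_abs; apply sqrt_le_1_alt; unfold Rsqr; nra. }
  destruct (real_pigeonhole (fun k => fst (c k)) (sqrt B) (sqrt d) P)
    as [P1 [i1 [s1 c1]]]; [now apply sqrt_lt_R0|apply hb|easy|].
  destruct (real_pigeonhole (fun k => snd (c k)) (sqrt B) (sqrt d) P1)
    as [P2 [i2 [s2 c2]]]; [now apply sqrt_lt_R0|apply hb|easy|].
  exists P2. split; [easy|]. split; [auto|]. intros k l hk hl.
  replace (c k *v v -v c l *v v) with ((fst (c k) - fst (c l), snd (c k) - snd (c l)) *v v)
    by (apply vec_ext; intro; inner_simpl; ring).
  rewrite n2_scal. unfold cn2; simpl fst; simpl snd.
  assert (sq : forall t, Rabs t <= sqrt d -> t ^ 2 <= d).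
  { intros t ht. rewrite <- pow2_abs, <- (sqrt_sqrt d) by lra.
    generalize (Rabs_pos t). nra. }
  assert (h1 := sq _ (c1 k l (s2 _ hk) (s2 _ hl))). assert (h2 := sq _ (c2 k l hk hl)).
  assert (e : 2 * d * (n2 v + 1) = eps) by (unfold d; field; lra). nra.
Qed.

Lemma precompact_lincomb m (c : nat -> nat -> C) (v : nat -> H) B :
  (forall k i, (i < m)%nat -> cn2 (c k i) <= B) ->
  precompact (fun k => hlincomb m (c k) v).
Proof.
  induction m; intros hB; simpl.
  - intros P hP eps he. exists P. split; [easy|]. split; [easy|]. intros.
    rewrite hadd_opp, n2_0. lra.
  - apply precompact_add; [apply IHm; auto|].
    apply precompact_scal with B. auto.
Qed.

Lemma precompact_approx u :
  (forall eps, 0 < eps -> exists w, precompact w /\ forall k, n2 (u k -v w k) <= eps) ->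
  precompact u.
Proof.
  (* The two triangle inequalities produce 2 + 4 + 4 = 10 twelfths of eps. *)
  intros h P hP eps he. destruct (h (eps / 12)) as [w [hw hc]]; [lra|].
  destruct (hw P hP (eps / 12)) as [P1 [i1 [s1 c1]]]; [lra|].
  exists P1. split; [easy|]. split; [easy|]. intros k l hk hl.
  generalize (n2_triangle (u k) (w k) (u l)) (n2_triangle (w k) (w l) (u l))
    (hc k) (hc l) (n2_sub_sym (w l) (u l)) (c1 k l hk hl). lra.
Qed.

(** A diagonal argument: nested infinite index sets with squared diameters at most 1/(n+1), and an
    increasing choice of one index from each. *)
Lemma precompact_subsequence u : precompact u ->
  exists phi, (forall n, (phi n < phi (S n))%nat) /\ cauchy (fun n => u (phi n)).
Proof.
  intros hu.
  (* A choice must exist for every history, even a meaningless one, so infinity of the previous set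
     is a premise inside [Q]; [hinf] discharges it by induction. *)
  set (Q := fun n (s : nat -> (nat -> Prop) * nat) (a : (nat -> Prop) * nat) =>
    match n with O => True | S m => infinite (fst (s m)) end ->
    infinite (fst a) /\ fst a (snd a) /\
    (forall k l, fst a k -> fst a l -> n2 (u k -v u l) <= / INR (S n)) /\
    match n with O => True
    | S m => (forall k, fst a k -> fst (s m) k) /\ (snd (s m) < snd a)%nat end).
  destruct (dependent_sequence (fun _ => True, O) Q) as [s hs].
  - intros n s s' a e. unfold Q. destruct n; [easy|]. now rewrite e by lia.
  - intros n s. unfold Q.
    set (P0 := match n with O => fun _ => True | S m => fst (s m) end).
    set (k0 := match n with O => O | S m => snd (s m) end).
    destruct (classic (infinite P0)) as [i|i].
    + destruct (hu P0 i (/ INR (S n))) as [P' [i' [s' c']]].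
      { apply Rinv_0_lt_compat, lt_0_INR. lia. }
      destruct (i' (S k0)) as [k [hk pk]].
      exists (P', k). intros _. simpl fst; simpl snd.
      split; [easy|]. split; [easy|]. split; [easy|].
      destruct n; [easy|]. split; [exact s'|exact hk].
    + exists (fun _ => True, O). intros hi. destruct i. unfold P0.
      destruct n; [|easy]. intros N. now exists N.
  - assert (hinf : forall n, infinite (fst (s n))).
    { induction n; [apply (hs O); easy|apply (hs (S n)); easy]. }
    exists (fun n => snd (s n)).
    assert (hs' := fun n => hs (S n) (hinf n)). assert (hs0 := hs O I). cbv beta iota in hs', hs0.
    split; [intros n; destruct (hs' n) as [_ [_ [_ [_ h]]]]; exact h|].
    assert (sub : forall n m, (n <= m)%nat -> forall k, fst (s m) k -> fst (s n) k).
    { intros n m l. induction l; [easy|]. intros k hk. apply IHl. destruct (hs' m) as [_ [_ [_ [h _]]]]. now apply h. }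
    assert (mem : forall n, fst (s n) (snd (s n))).
    { destruct n; [|destruct (hs' n) as [_ [h _]]; exact h].
      destruct hs0 as [_ [h _]]. exact h. }
    assert (cl : forall n k l, fst (s n) k -> fst (s n) l -> n2 (u k -v u l) <= / INR (S n)).
    { destruct n; [|destruct (hs' n) as [_ [_ [h _]]]; exact h].
      destruct hs0 as [_ [_ [h _]]]. exact h. }
    intros eps he. destruct (archimed_cor1 eps he) as [N [hN hN0]].
    exists N. intros m n hm hn. eapply Rle_lt_trans; [|exact hN].
    eapply Rle_trans; [apply (cl N); eapply sub, mem; easy|].
    apply Rinv_le_contravar; [now apply lt_0_INR|]. apply le_INR. lia.
Qed.

End Precompact.

(** * Maximization and greedy diagonalization of quadratic forms *)

Section Forms.
Context {H : HilbertSpace}.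
Implicit Types x y z v : H.

(* The real part of a Hermitian form; the imaginary part is recovered by
   inserting a factor [i] in one argument. *)
Definition bounded_form (b : H -> H -> R) (K : R) :=
  0 <= K /\ (forall x y, b x y = b y x) /\
  (forall x y z, b (x +v y) z = b x z + b y z) /\
  (forall t x z, b ((t, 0) *v x) z = t * b x z) /\
  (forall x y, b x y ^ 2 <= K * (n2 x * n2 y)).

Lemma n2_limit_le1 u (l : H) : converges u l -> (forall n, n2 (u n) <= 1) -> n2 l <= 1.
Proof.
  intros hu h1. apply Rnot_lt_le. intros hgt.
  set (t := (n2 l - 1) / 4). assert (ht : 0 < t) by (unfold t; lra).
  assert (hit := Rinv_0_lt_compat t ht).
  destruct (hu (t / (1 + / t))) as [N hN]; [apply Rdiv_lt_0_compat; lra|].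
  specialize (hN N (Nat.le_refl N)). rewrite n2_sub_sym in hN.
  assert (e : t / (1 + / t) * (1 + / t) = t) by (field; lra).
  (* Young's inequality with weight t, since a factor 2 would lose the exact bound 1. The right side
     is at most 1 + 2t, while [n2 l] is 1 + 4t. *)
  assert (b : n2 l <= (1 + t) * n2 (u N) + (1 + / t) * n2 (l -v u N)).
  { replace ((1 + t) * n2 (u N) + (1 + / t) * n2 (l -v u N)) with
      (n2 l + / t * n2 ((t, 0) *v u N -v (l -v u N))).
    - generalize (n2_pos ((t, 0) *v u N -v (l -v u N))). nra.
    - inner_simpl. rewrite (re_sym l (u N)). field. lra. }
  assert ((1 + / t) * n2 (l -v u N) <= t) by nra.
  specialize (h1 N). assert (n2 l = 4 * t + 1) by (unfold t; lra). nra.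
Qed.

Section OneForm.
Variables (b : H -> H -> R) (K : R).
Hypothesis b_form : bounded_form b K.

Let K_pos : 0 <= K := proj1 b_form.
Let b_sym x y : b x y = b y x := proj1 (proj2 b_form) x y.
Let b_add x y z : b (x +v y) z = b x z + b y z := proj1 (proj2 (proj2 b_form)) x y z.
Let b_scal t x z : b ((t, 0) *v x) z = t * b x z :=
  proj1 (proj2 (proj2 (proj2 b_form))) t x z.
Let b_bound x y : b x y ^ 2 <= K * (n2 x * n2 y) :=
  proj2 (proj2 (proj2 (proj2 b_form))) x y.

Lemma form_add_r x y z : b z (x +v y) = b z x + b z y.
Proof. now rewrite b_sym, b_add, (b_sym x), (b_sym y). Qed.

Lemma form_scal_r t x z : b z ((t, 0) *v x) = t * b z x.
Proof. now rewrite b_sym, b_scal, (b_sym x). Qed.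

Lemma form_opp x z : b (hopp x) z = - b x z.
Proof.
  replace (hopp x) with ((-1, 0) *v x) by (apply vec_ext; intro; inner_simpl; ring).
  rewrite b_scal. ring.
Qed.

Lemma form_opp_r x z : b z (hopp x) = - b z x.
Proof. now rewrite b_sym, form_opp, (b_sym x). Qed.

Lemma form_parallelogram x y :
  b (x +v y) (x +v y) + b (x -v y) (x -v y) = 2 * b x x + 2 * b y y.
Proof.
  rewrite !b_add, !form_add_r, !form_opp, !form_opp_r, (b_sym y x). ring.
Qed.

(** K + 1 stands in for sqrt K, since K <= (K+1)^2. *)
Lemma form_small x y d e : 0 <= d -> 0 <= e -> n2 x <= d * d -> n2 y <= e * e ->
  Rabs (b x y) <= (K + 1) * (d * e).
Proof.
  intros hd he hx hy. assert (hb := b_bound x y).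
  assert (px := n2_pos x). assert (py := n2_pos y).
  rewrite <- (Rabs_pos_eq ((K + 1) * (d * e))) by (apply Rmult_le_pos; nra).
  apply Rsqr_le_abs_0. unfold Rsqr.
  assert (h1 : n2 x * n2 y <= (d * d) * (e * e)) by (apply Rmult_le_compat; auto).
  assert (h2 : K * (n2 x * n2 y) <= K * ((d * d) * (e * e)))
    by (apply Rmult_le_compat_l; auto).
  assert (h3 : 0 <= (d * d) * (e * e)) by (apply Rmult_le_pos; nra).
  nra.
Qed.

Lemma form_limit u l : converges u l -> (forall n, n2 (u n) <= 1) ->
  forall eps, 0 < eps -> exists N, forall n, (N <= n)%nat ->
  Rabs (b l l - b (u n) (u n)) <= eps.
Proof.
  (* The difference splits into two form values with second arguments of norm at most 2 and 1,
     whence 3 (K+1) d. *)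
  intros hu h1 eps he. set (d := Rmin 1 (eps / (3 * (K + 1)))).
  assert (hd0 : 0 < eps / (3 * (K + 1))) by (apply Rdiv_lt_0_compat; lra).
  assert (hd : 0 < d) by (apply Rmin_glb_lt; lra).
  assert (d1 : d <= 1) by apply Rmin_l.
  assert (d2 : (3 * (K + 1)) * d <= eps).
  { apply Rle_trans with ((3 * (K + 1)) * (eps / (3 * (K + 1)))).
    - apply Rmult_le_compat_l; [lra|apply Rmin_r].
    - right. field. lra. }
  destruct (hu (d * d)) as [N hN]; [nra|]. exists N. intros n hn.
  assert (c := hN n hn). rewrite n2_sub_sym in c.
  assert (hl : n2 l <= 2 * 2).
  { replace l with ((l -v u n) +v u n) by (apply vec_ext; intro; inner_simpl; ring).
    generalize (n2_add_le (l -v u n) (u n)) (h1 n). nra. }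
  replace (b l l - b (u n) (u n)) with (b (l -v u n) l + b (l -v u n) (u n)).
  - eapply Rle_trans; [apply Rabs_triang|].
    assert (e1 := form_small (l -v u n) l d 2 ltac:(lra) ltac:(lra) ltac:(lra) hl).
    assert (e2 := form_small (l -v u n) (u n) d 1 ltac:(lra) ltac:(lra) ltac:(lra)
      ltac:(rewrite Rmult_1_l; auto)).
    nra.
  - rewrite !b_add, !form_opp, (b_sym (u n) l). ring.
Qed.

Lemma form_n2_0 x : n2 x = 0 -> b x x = 0.
Proof. intros h. generalize (b_bound x x). rewrite h. nra. Qed.

Section Maximizer.
Variable W : H -> Prop.
Hypothesis W_0 : W h0.
Hypothesis W_add : forall x y, W x -> W y -> W (x +v y).
Hypothesis W_scal : forall t x, W x -> W ((t, 0) *v x).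
Hypothesis W_closed : forall u l, (forall n, W (u n)) -> converges u l -> W l.
(** Compactness is required of the form rather than of the vectors. This covers Re <Tx,Ty> for
    compact T as well as forms on finite-dimensional spaces. *)
Hypothesis b_compact : forall u, (forall n, W (u n)) -> (forall n, n2 (u n) <= 1) ->
  exists phi, (forall n, (phi n < phi (S n))%nat) /\
  forall eps, 0 < eps -> exists N, forall m n, (N <= m)%nat -> (N <= n)%nat ->
    b (u (phi m) -v u (phi n)) (u (phi m) -v u (phi n)) < eps.

Lemma form_normalize x : b x x = n2 x * b (normalize x) (normalize x).
Proof.
  rewrite (normalize_scal x) at 1 2. rewrite b_scal, form_scal_r, <- Rmult_assoc.
  now rewrite sqrt_sqrt by apply n2_pos.
Qed.

(** lam is the supremum of the form over the unit ball of W; using the ball instead of the sphere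
    makes it nonnegative even if W is trivial. *)
Lemma form_sup : exists lam, 0 <= lam /\ (forall x, W x -> b x x <= lam * n2 x) /\
  forall d, 0 < d -> exists x, W x /\ n2 x <= 1 /\ lam - d < b x x.
Proof.
  set (E := fun t => exists x, W x /\ n2 x <= 1 /\ t = b x x).
  destruct (completeness E) as [lam [ub lub]].
  - exists (K + 1). intros t [x [hx [h1 ->]]].
    assert (hs := form_small x x 1 1 ltac:(lra) ltac:(lra) ltac:(lra) ltac:(lra)).
    generalize (Rle_abs (b x x)). lra.
  - exists (b h0 h0), h0. rewrite n2_0. split; [easy|]. split; [lra|easy].
  - exists lam. split; [|split].
    + apply ub. exists h0. split; [easy|]. rewrite form_n2_0, n2_0; [lra|apply n2_0].
    + intros x hx. rewrite form_normalize, Rmult_comm.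
      apply Rmult_le_compat_r; [apply n2_pos|]. apply ub.
      exists (normalize x). split; [|split; [|easy]].
      * unfold normalize. destruct (Req_EM_T (n2 x) 0); auto.
      * destruct (normalize_cases x) as [-> | ->]; rewrite ?n2_0; lra.
    + intros d hd. apply NNPP. intros hn.
      assert (lam <= lam - d); [|lra]. apply lub. intros t [x [hx [h1 ->]]].
      apply Rnot_lt_le. intros hlt. apply hn. now exists x.
Qed.

(** A maximizing sequence converges in norm by comparing two parallelogram laws, and the first
    variation at the limit gives the orthogonality. *)
Lemma form_maximizer : exists lam v, 0 <= lam /\ W v /\
  (v = h0 \/ n2 v = 1) /\ (lam = 0 -> v = h0) /\ (lam <> 0 -> n2 v = 1) /\
  (forall x, W x -> b x x <= lam * n2 x) /\ b v v = lam * n2 v /\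
  (forall x, W x -> hinner x v = C0 -> b v x = 0).
Proof.
  destruct form_sup as [lam [hl [hub happ]]]. exists lam.
  (* The convergence argument divides by lam. For lam = 0 the value h0 is returned; it pads the
     greedy sequence once the form is exhausted. *)
  destruct (Req_dec lam 0) as [e|ne].
  { exists h0. split; [easy|]. split; [easy|]. split; [now left|].
    split; [easy|]. split; [easy|]. split; [easy|].
    split; [rewrite form_n2_0, n2_0; [ring|apply n2_0]|].
    intros x _ _. generalize (b_bound h0 x). rewrite n2_0. nra. }
  assert (lp : 0 < lam) by lra.
  assert (hx : exists u : nat -> H, forall n, W (u n) /\ n2 (u n) <= 1 /\
     lam - / INR (S n) < b (u n) (u n)).
  { apply (dependent_sequence h0
      (fun n _ x => W x /\ n2 x <= 1 /\ lam - / INR (S n) < b x x)); [easy|].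
    intros n _. apply happ, Rinv_0_lt_compat, lt_0_INR. lia. }
  destruct hx as [u hu].
  destruct (b_compact u) as [phi [hphi hc]]; [apply hu|apply hu|].
  assert (phi_ge : forall n, (n <= phi n)%nat).
  { induction n; [lia|]. specialize (hphi n). lia. }
  assert (near : forall n, lam - / INR (S n) < b (u (phi n)) (u (phi n))).
  { intros n. eapply Rle_lt_trans; [|apply hu]. apply Rplus_le_compat_l, Ropp_le_contravar.
    apply Rinv_le_contravar; [apply lt_0_INR; lia|apply le_INR]. specialize (phi_ge n). lia. }
  assert (small : forall d, 0 < d -> exists N, forall n, (N <= n)%nat ->
    lam - d < b (u (phi n)) (u (phi n))).
  { intros d hd. destruct (archimed_cor1 d hd) as [N [hN hN0]]. exists N. intros n hn.
    eapply Rlt_trans; [|apply near].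
    assert (/ INR (S n) <= / INR N); [|lra].
    apply Rinv_le_contravar; [now apply lt_0_INR|apply le_INR; lia]. }
  destruct (cauchy_converges (fun n => u (phi n))) as [v hv].
  { intros eps he. assert (hel : 0 < eps * lam / 8) by (apply Rdiv_lt_0_compat; nra).
    destruct (small _ hel) as [N1 h1]. destruct (hc _ hel) as [N2 h2].
    exists (N1 + N2)%nat. intros m n hm hn.
    specialize (h2 m n ltac:(lia) ltac:(lia)).
    assert (a1 := h1 m ltac:(lia)). assert (a2 := h1 n ltac:(lia)).
    (* From the laws for b and for n2, with b(u_m + u_n) <= lam n2(u_m + u_n): lam n2(u_m - u_n) <=
       4 lam - 2 b(u_m) - 2 b(u_n) + b(u_m - u_n), which is below 5/8 of eps lam. *)
    assert (a3 := form_parallelogram (u (phi m)) (u (phi n))).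
    assert (a4 := hub (u (phi m) +v u (phi n))
      (W_add _ _ (proj1 (hu _)) (proj1 (hu _)))).
    assert (a5 := parallelogram (u (phi m)) (u (phi n))).
    destruct (hu (phi m)) as [_ [b1 _]]. destruct (hu (phi n)) as [_ [b2 _]].
    assert (lam * n2 (u (phi m) -v u (phi n)) < lam * eps); [nra|].
    now apply Rmult_lt_reg_l with lam. }
  exists v.
  assert (Wv : W v) by (eapply W_closed; [|exact hv]; intros n; apply hu).
  assert (n1 : n2 v <= 1).
  { eapply n2_limit_le1; [exact hv|]. intros n; apply hu. }
  assert (bl : lam <= b v v).
  { apply Rnot_lt_le. intros hlt.
    destruct (form_limit _ _ hv (fun n => proj1 (proj2 (hu (phi n)))) ((lam - b v v) / 3))
      as [N1 h1]; [lra|].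
    destruct (small ((lam - b v v) / 3)) as [N2 h2]; [lra|].
    specialize (h1 (N1 + N2)%nat ltac:(lia)). specialize (h2 (N1 + N2)%nat ltac:(lia)).
    simpl in h1. rewrite Rabs_minus_sym in h1. generalize (Rle_abs
      (b (u (phi (N1 + N2)%nat)) (u (phi (N1 + N2)%nat)) - b v v)). lra. }
  assert (bu := hub v Wv).
  assert (nv : n2 v = 1) by nra.
  assert (bv : b v v = lam) by nra.
  split; [easy|]. split; [easy|]. split; [now right|]. split; [easy|].
  split; [easy|]. split; [easy|]. split; [rewrite nv; lra|].
  intros x hx ho. set (be := b v x).
  set (M := lam * n2 x - b x x). assert (hM : 0 <= M) by (generalize (hub x hx); unfold M; lra).
  (* First variation: maximality at v + t x bounds a term linear in t by a quadratic one; t =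
     be/(M+1) then forces be = 0. *)
  assert (q : forall t, 2 * t * be <= t * t * M).
  { intros t. assert (h := hub (v +v (t, 0) *v x) (W_add _ _ Wv (W_scal t x hx))).
    rewrite !b_add, !form_add_r, !b_scal, !form_scal_r, (b_sym x v), bv in h.
    assert (nn : n2 (v +v (t, 0) *v x) = 1 + t * t * n2 x).
    { unfold n2 at 1. autorewrite with inner. simpl fst; simpl snd.
      rewrite (re_eq0 _ _ ho), (re_sym x v), (re_eq0 _ _ ho).
      fold (n2 v) (n2 x). rewrite nv. ring. }
    rewrite nn in h. unfold M. fold be in h. nra. }
  specialize (q (be / (M + 1))).
  assert (e : be / (M + 1) * (M + 1) = be) by (field; lra).
  set (s := be / (M + 1)) in *. rewrite <- e in q.
  assert (s * s * (M + 2) <= 0) by nra.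
  assert (s = 0) by nra. rewrite <- e. nra.
Qed.

End Maximizer.

Section Greedy.
Variable V : H -> Prop.
Hypothesis V_0 : V h0.
Hypothesis V_add : forall x y, V x -> V y -> V (x +v y).
Hypothesis V_scal : forall a x, V x -> V (a *v x).
Hypothesis V_closed : forall u l, (forall n, V (u n)) -> converges u l -> V l.
Hypothesis b_compact : forall u, (forall n, V (u n)) -> (forall n, n2 (u n) <= 1) ->
  exists phi, (forall n, (phi n < phi (S n))%nat) /\
  forall eps, 0 < eps -> exists N, forall m n, (N <= m)%nat -> (N <= n)%nat ->
    b (u (phi m) -v u (phi n)) (u (phi m) -v u (phi n)) < eps.

(** A spectral decomposition stated without an operator: [diag_orth] replaces the eigenvector
    equation, and zero values come with zero vectors. *)
Record diagonalizes (v : nat -> H) (lam : nat -> R) : Prop := {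
  diag_ons : orthonormal0 v;
  diag_mem : forall j, V (v j);
  diag_pos : forall j, 0 <= lam j;
  diag_noninc : forall j, lam (S j) <= lam j;
  diag_zero : forall j, lam j = 0 -> v j = h0;
  diag_unit : forall j, lam j <> 0 -> n2 (v j) = 1;
  diag_bound : forall j x, V x -> (forall i, (i < j)%nat -> hinner x (v i) = C0) ->
    b x x <= lam j * n2 x;
  diag_value : forall j, b (v j) (v j) = lam j * n2 (v j);
  diag_orth : forall j x, V x -> (forall i, (i <= j)%nat -> hinner x (v i) = C0) ->
    b (v j) x = 0 }.

Lemma orth_closed (u : nat -> H) l y : converges u l ->
  (forall n, hinner (u n) y = C0) -> hinner l y = C0.
Proof.
  intros hu h.
  assert (e : ip2 l y <= 0).
  { apply le_epsilon_mult with (n2 y); [apply n2_pos|]. intros d hd.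
    destruct (hu d hd) as [N hN]. specialize (hN N (Nat.le_refl N)).
    rewrite n2_sub_sym in hN.
    replace (ip2 l y) with (ip2 (l -v u N) y).
    - generalize (cauchy_schwarz (l -v u N) y) (n2_pos y). nra.
    - inner_simpl. rewrite (re_eq0 _ _ (h N)), (im_eq0 _ _ (h N)). ring. }
  rewrite ip2_re_im in e. apply hinner_eq0; nra.
Qed.

(** Each step maximizes the form on the part of V orthogonal to the vectors already found; these
    subspaces shrink, so the maxima decrease. *)
Lemma greedy_diagonalization : exists (v : nat -> H) lam, diagonalizes v lam.
Proof.
  set (W := fun n (s : nat -> H * R) x => V x /\
    forall i, (i < n)%nat -> hinner x (fst (s i)) = C0).
  destruct (dependent_sequence (h0, 0) (fun n s a =>
    0 <= snd a /\ W n s (fst a) /\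
    (fst a = h0 \/ n2 (fst a) = 1) /\ (snd a = 0 -> fst a = h0) /\
    (snd a <> 0 -> n2 (fst a) = 1) /\
    (forall x, W n s x -> b x x <= snd a * n2 x) /\
    b (fst a) (fst a) = snd a * n2 (fst a) /\
    (forall x, W n s x -> hinner x (fst a) = C0 -> b (fst a) x = 0))) as [s hs].
  - intros n s s' a e.
    assert (eW : forall x, W n s x <-> W n s' x).
    { intros x. unfold W. split; intros [h1 h2]; (split; [easy|]); intros i hi.
      - rewrite <- e by easy. auto.
      - rewrite e by easy. auto. }
    intros [h1 [h2 [h3 [h4 [h5 [h6 [h7 h8]]]]]]].
    split; [easy|]. split; [now apply eW|]. split; [easy|]. split; [easy|].
    split; [easy|]. split; [intros x hx; apply h6, eW, hx|]. split; [easy|].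
    intros x hx. apply h8, eW, hx.
  - intros n s.
    destruct (form_maximizer (W n s)) as [lam [v h]].
    + split; [easy|]. intros. apply hinner_eq0; now autorewrite with inner.
    + intros x y [h1 h2] [h3 h4]. split; [auto|]. intros i hi.
      apply hinner_eq0; autorewrite with inner;
      rewrite ?(re_eq0 _ _ (h2 i hi)), ?(re_eq0 _ _ (h4 i hi)),
        ?(im_eq0 _ _ (h2 i hi)), ?(im_eq0 _ _ (h4 i hi)); ring.
    + intros t x [h1 h2]. split; [auto|]. intros i hi.
      apply hinner_eq0; autorewrite with inner;
      rewrite (re_eq0 _ _ (h2 i hi)), (im_eq0 _ _ (h2 i hi)); ring.
    + intros u l hu hl. split.
      * apply V_closed with u; [intros; apply hu|easy].
      * intros i hi. apply (orth_closed u); [easy|]. intros k. now apply hu.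
    + intros u hu. apply b_compact. intros. apply hu.
    + exists (v, lam). exact h.
  - exists (fun n => fst (s n)), (fun n => snd (s n)).
    assert (o : forall i j, (j < i)%nat -> hinner (fst (s i)) (fst (s j)) = C0).
    { intros i j hij. destruct (hs i) as [_ [[_ h] _]]. now apply h. }
    split.
    + split.
      * intros i j hij. destruct (Nat.lt_total i j) as [l|[l|l]]; [|easy|now apply o].
        now apply hinner_eq0_sym, o.
      * intros i. apply hs.
    + intros j. apply hs.
    + intros j. apply hs.
    + intros j. destruct (Req_dec (snd (s (S j))) 0) as [e|e].
      * rewrite e. apply hs.
      * destruct (hs (S j)) as [_ [[h1 h2] [_ [_ [h3 [_ [h4 _]]]]]]].
        rewrite (h3 e) in h4.
        destruct (hs j) as [_ [_ [_ [_ [_ [h5 _]]]]]].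
        assert (hw : W j s (fst (s (S j)))) by (split; auto).
        specialize (h5 _ hw). rewrite h4, (h3 e) in h5. lra.
    + intros j. apply hs.
    + intros j. apply hs.
    + intros j x h1 h2. apply hs. now split.
    + intros j. apply hs.
    + intros j x h1 h2. apply hs; [split; [easy|]|]; auto using Nat.lt_le_incl.
Qed.

End Greedy.
End OneForm.
End Forms.
Lemma Cmod_cn2 z : Cmod z = sqrt (cn2 z).
Proof. reflexivity. Qed.

Lemma cn2_pos z : 0 <= cn2 z.
Proof. unfold cn2. nra. Qed.

Lemma Cmod_triangle z w : Cmod (Cadd z w) <= Cmod z + Cmod w.
Proof.
  rewrite !Cmod_cn2. assert (hz := cn2_pos z). assert (hw := cn2_pos w).
  assert (pz := sqrt_pos (cn2 z)). assert (pw := sqrt_pos (cn2 w)).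
  rewrite <- (sqrt_square (sqrt (cn2 z) + sqrt (cn2 w))) by lra.
  apply sqrt_le_1_alt.
  assert (ez := sqrt_sqrt _ hz). assert (ew := sqrt_sqrt _ hw).
  assert (d : fst z * fst w + snd z * snd w <= sqrt (cn2 z) * sqrt (cn2 w)).
  { rewrite <- sqrt_mult by easy. eapply Rle_trans; [apply Rle_abs|].
    rewrite <- sqrt_Rsqr_abs. apply sqrt_le_1_alt. unfold Rsqr, cn2.
    assert (0 <= (fst z * snd w - snd z * fst w) ^ 2) by apply pow2_ge_0. nra. }
  assert (e : cn2 (Cadd z w) = cn2 z + cn2 w + 2 * (fst z * fst w + snd z * snd w))
    by (unfold cn2, Cadd; simpl fst; simpl snd; ring).
  rewrite e. nra.
Qed.

Lemma sqrt_mult_le a b : 0 <= a -> 0 <= b -> sqrt (a * b) <= (a + b) / 2.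
Proof.
  intros ha hb. rewrite <- (sqrt_square ((a + b) / 2)) by lra.
  apply sqrt_le_1_alt. assert (0 <= (a - b) ^ 2) by apply pow2_ge_0. nra.
Qed.

(** * Singular value decomposition and Bessel families *)

Section SingularValueDecomposition.
Context {H : HilbertSpace}.
Implicit Types (x y z : H) (T : H -> H) (v u : nat -> H) (s : nat -> R).

Lemma Cmod_inner x y : Cmod (hinner x y) = sqrt (ip2 x y).
Proof. reflexivity. Qed.

Lemma Cmod_inner_add x y z :
  Cmod (hinner (x +v y) z) <= Cmod (hinner x z) + Cmod (hinner y z).
Proof. rewrite hinner_add_l. apply Cmod_triangle. Qed.

Lemma Cmod_inner_lincomb n c (w : nat -> H) z :
  Cmod (hinner (hlincomb n c w) z) <= rsum n (fun i => Cmod (hinner (c i *v w i) z)).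
Proof.
  induction n; simpl.
  - rewrite Cmod_inner, ip2_re_im, re_0_l, im_0_l. replace (0 ^ 2 + 0 ^ 2) with 0 by ring.
    rewrite sqrt_0. lra.
  - generalize (Cmod_inner_add (hlincomb n c w) (c n *v w n) z). lra.
Qed.

Lemma ip2_scal_l a x y : ip2 (a *v x) y = cn2 a * ip2 x y.
Proof. inner_simpl. ring. Qed.

(** The expansion of T is encoded by its remainders: [svd_bound] is the norm of T beyond the first j
    terms, and [svd_orth] says that later parts of T miss u_j. *)
Record svd T v u s : Prop := {
  svd_v : orthonormal0 v;
  svd_u : orthonormal0 u;
  svd_pos : forall j, 0 <= s j;
  svd_noninc : forall j, s (S j) <= s j;
  svd_zero : forall j, s j = 0 -> v j = h0;
  svd_unit : forall j, s j <> 0 -> n2 (v j) = 1;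
  svd_unit_u : forall j, s j <> 0 -> n2 (u j) = 1;
  svd_apply : forall j, T (v j) = (s j, 0) *v u j;
  svd_bound : forall j x, (forall i, (i < j)%nat -> hinner x (v i) = C0) ->
    n2 (T x) <= s j ^ 2 * n2 x;
  svd_orth : forall j x, (forall i, (i <= j)%nat -> hinner x (v i) = C0) ->
    hinner (T x) (u j) = C0 }.

(** The form Re <Tx,Ty> belongs to T^*T, so its successive maxima are the squares of the singular
    values, and u_j = T v_j / s_j. *)
Lemma compact_svd T : linear_op T -> bounded_op T -> compact_op T ->
  exists v u s, svd T v u s.
Proof.
  intros hT hb hc. destruct (bounded_n2 T hb) as [K [hK hKT]].
  destruct (greedy_diagonalization (fun x y => re (T x) (T y)) (K * K)) with
    (V := fun _ : H => True) as [v [lam hd]]; try easy.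
  - split; [nra|]. split; [intros; apply re_sym|].
    split; [intros; rewrite (proj1 hT); apply re_add_l|].
    split; [intros; rewrite (proj2 hT), re_scal_l; simpl; ring|].
    intros x y. apply Rle_trans with (n2 (T x) * n2 (T y)).
    + generalize (cauchy_schwarz (T x) (T y)). rewrite ip2_re_im. nra.
    + replace (K * K * (n2 x * n2 y)) with ((K * n2 x) * (K * n2 y)) by ring.
      apply Rmult_le_compat; auto using n2_pos.
  - intros w _ hw. destruct (hc w) as [phi [hphi [l hl]]].
    { exists 1. intros n. unfold hnorm. rewrite <- sqrt_1. apply sqrt_le_1_alt, hw. }
    exists phi. split; [easy|].
    assert (cv : converges (fun n => T (w (phi n))) l).
    { intros eps he. destruct (hl (sqrt eps)) as [N hN]; [now apply sqrt_lt_R0|].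
      exists N. intros n hn. rewrite <- (sqrt_sqrt eps) by lra. apply n2_lt, hN, hn. }
    intros eps he. destruct (converges_cauchy _ _ cv eps he) as [N hN].
    exists N. intros m n hm hn. rewrite linear_sub by easy. now apply hN.
  - assert (ho : forall j x, (forall i, (i <= j)%nat -> hinner x (v i) = C0) ->
      hinner (T x) (T (v j)) = C0).
    { intros j x hx. apply hinner_eq0_sym, hinner_eq0.
      - now apply (diag_orth _ _ _ _ hd).
      - assert (h := diag_orth _ _ _ _ hd j ((0, 1) *v x) I).
        simpl in h. rewrite (proj2 hT), re_scal_r in h. simpl in h.
        rewrite Rmult_0_l, Rmult_1_l, Rplus_0_l in h. apply h.
        intros i hi. apply hinner_eq0; autorewrite with inner;
        rewrite (re_eq0 _ _ (hx i hi)), (im_eq0 _ _ (hx i hi)); ring. }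
    assert (lp := diag_pos _ _ _ _ hd). assert (hv := diag_ons _ _ _ _ hd).
    assert (sz : forall j, sqrt (lam j) = 0 -> lam j = 0).
    { intros j hj. now apply sqrt_eq_0. }
    set (u := fun j => if Req_EM_T (lam j) 0 then h0 else (/ sqrt (lam j), 0) *v T (v j)).
    assert (zs : forall (c : C) (y : H), y = h0 -> c *v y = h0).
    { intros c y ->. apply vec_ext; intro; inner_simpl; ring. }
    assert (uorth : forall j x, hinner x (T (v j)) = C0 -> hinner x (u j) = C0).
    { intros j x hx. unfold u. destruct (Req_EM_T (lam j) 0);
      apply hinner_eq0; autorewrite with inner;
      rewrite ?(re_eq0 _ _ hx), ?(im_eq0 _ _ hx); simpl; ring. }
    assert (vorth : forall i j, (i < j)%nat -> hinner (T (v j)) (T (v i)) = C0).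
    { intros i j hij. apply ho. intros k hk. apply hv. lia. }
    assert (uu : forall j, lam j <> 0 -> n2 (u j) = 1).
    { intros j hj. unfold u. destruct (Req_EM_T (lam j) 0) as [e|e]; [easy|].
      rewrite n2_scal. assert (val := diag_value _ _ _ _ hd j).
      rewrite (diag_unit _ _ _ _ hd j e) in val. unfold n2. rewrite val.
      unfold cn2; simpl fst; simpl snd.
      assert (0 < sqrt (lam j)) by (apply sqrt_lt_R0; specialize (lp j); lra).
      rewrite <- (sqrt_sqrt (lam j)) at 2 by apply lp. field. lra. }
    exists v, u, (fun j => sqrt (lam j)). split.
    + easy.
    + split.
      * assert (o : forall i j, (i < j)%nat -> hinner (u j) (u i) = C0).
        { intros i j hij. apply uorth, hinner_eq0_sym, uorth, hinner_eq0_sym, vorth, hij. }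
        intros i j hij. destruct (Nat.lt_total i j) as [l|[l|l]]; [|easy|now apply o].
        now apply hinner_eq0_sym, o.
      * intros j. destruct (Req_dec (lam j) 0) as [e|e]; [left|right; auto].
        unfold u. now destruct (Req_EM_T (lam j) 0).
    + intros j. apply sqrt_pos.
    + intros j. apply sqrt_le_1_alt, (diag_noninc _ _ _ _ hd).
    + intros j hj. apply (diag_zero _ _ _ _ hd), sz, hj.
    + intros j hj. apply (diag_unit _ _ _ _ hd). intros e. apply hj. rewrite e. apply sqrt_0.
    + intros j hj. apply uu. intros e. apply hj. rewrite e. apply sqrt_0.
    + intros j. unfold u. destruct (Req_EM_T (lam j) 0) as [e|e].
      * rewrite (diag_zero _ _ _ _ hd j e), linear_0 by easy. symmetry. now apply zs.
      * assert (0 < sqrt (lam j)) by (apply sqrt_lt_R0; specialize (lp j); lra).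
        apply vec_ext; intro z. inner_simpl. field. lra.
    + intros j x hx. rewrite pow2_sqrt by apply lp. now apply (diag_bound _ _ _ _ hd).
    + intros j x hx. apply uorth, ho, hx.
Qed.

(** Bessel's inequality tested on f_i itself contains the term [n2 (f i) ^ 2]. *)
Lemma bessel_n2_le1 (f : nat -> H) n i : (i < n)%nat ->
  (forall x, rsum n (fun i => ip2 x (f i)) <= n2 x) -> n2 (f i) <= 1.
Proof.
  intros hi hf. assert (h := hf (f i)).
  assert (t := rsum_ge_term n (fun j => ip2 (f i) (f j)) i hi (fun j => ip2_pos _ _)).
  simpl in t. rewrite ip2_re_im, im_self in t. fold (n2 (f i)) in t.
  assert (p := n2_pos (f i)). nra.
Qed.

(** Write x = P x + r with P the projection on v_0, ..., v_{J-1}. Since T r is orthogonal to u_0,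
    ..., u_{J-1}, x may be replaced by its u-residual in <T r, x>; each product is then split by the
    arithmetic-geometric mean inequality. *)
Lemma svd_quadratic_form_le T v u s J x : linear_op T -> svd T v u s ->
  Cmod (hinner (T x) x) <= rsum J (fun k => (ip2 x (v k) + ip2 x (u k)) / 2 * s k)
    + (n2 (x -v proj J v x) + n2 (x -v proj J u x)) / 2 * s J.
Proof.
  intros hT hs. set (r := x -v proj J v x). set (r' := x -v proj J u x).
  assert (orth : forall k, (k < J)%nat -> hinner (T r) (u k) = C0).
  { intros k hk. apply (svd_orth _ _ _ _ hs). intros i hi.
    apply residual_orth; [apply hs|lia]. }
  assert (dec : T x = hlincomb J (fun k => hinner x (v k)) (fun k => T (v k)) +v T r).
  { rewrite <- linear_lincomb, <- (proj1 hT) by easy. f_equal. unfold r, proj.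
    apply vec_ext; intro; inner_simpl; ring. }
  rewrite dec. eapply Rle_trans; [apply Cmod_inner_add|]. apply Rplus_le_compat.
  - eapply Rle_trans; [apply Cmod_inner_lincomb|]. apply rsum_le. intros k hk.
    rewrite (svd_apply _ _ _ _ hs), Cmod_inner, !ip2_scal_l.
    fold (ip2 x (v k)). rewrite (ip2_sym (u k) x).
    assert (p := svd_pos _ _ _ _ hs k).
    replace (ip2 x (v k) * (cn2 (s k, 0) * ip2 x (u k)))
      with ((s k * s k) * (ip2 x (v k) * ip2 x (u k)))
      by (unfold cn2; simpl fst; simpl snd; ring).
    rewrite sqrt_mult, sqrt_square, Rmult_comm; auto using Rmult_le_pos, ip2_pos.
    apply Rmult_le_compat_r; [easy|]. apply sqrt_mult_le; apply ip2_pos.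
  - assert (e : hinner (T r) x = hinner (T r) r').
    { assert (z : hinner (T r) (proj J u x) = C0).
      { apply hinner_eq0_sym, lincomb_orth. intros i hi. now apply hinner_eq0_sym, orth. }
      rewrite (hinner_re_im (T r) x), (hinner_re_im (T r) r'). unfold r'.
      autorewrite with inner. rewrite (re_eq0 _ _ z), (im_eq0 _ _ z). f_equal; ring. }
    rewrite e, Cmod_inner. assert (p := svd_pos _ _ _ _ hs J).
    apply Rle_trans with (sqrt ((s J * s J) * (n2 r * n2 r'))).
    + apply sqrt_le_1_alt. eapply Rle_trans; [apply cauchy_schwarz|].
      rewrite <- Rmult_assoc. apply Rmult_le_compat_r; [apply n2_pos|].
      replace (s J * s J) with (s J ^ 2) by ring. apply (svd_bound _ _ _ _ hs).
      intros i hi. apply residual_orth; [apply hs|easy].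
    + rewrite sqrt_mult, sqrt_square, Rmult_comm; auto using Rmult_le_pos, n2_pos.
      apply Rmult_le_compat_r; [easy|]. apply sqrt_mult_le; apply n2_pos.
Qed.

Lemma svd_bessel_sum T v u s p B n (f : nat -> H) : 1 <= p -> linear_op T ->
  svd T v u s -> (forall J, rsum J (fun j => rpow (s j) p) <= B) ->
  (forall x, rsum n (fun i => ip2 x (f i)) <= n2 x) ->
  rsum n (fun i => rpow (Cmod (hinner (T (f i)) (f i))) p) <= B + 1.
Proof.
  intros hp hT hs hB hf.
  (* With s_J^p < 1/(n+1) and residual column sum at most n, the last column contributes less than
     1. *)
  assert (hn : 0 < / (INR n + 1)) by
    (apply Rinv_0_lt_compat; generalize (pos_INR n); lra).
  destruct (summable_rpow_small p s B hp (svd_noninc _ _ _ _ hs) hB _ hn) as [J hJ].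
  specialize (hJ J (Nat.le_refl J)).
  set (w := fun i k => if Nat.ltb k J then (ip2 (f i) (v k) + ip2 (f i) (u k)) / 2
    else (n2 (f i -v proj J v (f i)) + n2 (f i -v proj J u (f i))) / 2).
  set (c := fun k => if Nat.ltb k J then 1 else INR n).
  assert (wk : forall i k, (k < J)%nat -> w i k = (ip2 (f i) (v k) + ip2 (f i) (u k)) / 2)
    by (intros i k hk; unfold w; destruct (Nat.ltb_spec k J); [easy|lia]).
  assert (wJ : forall i, w i J =
     (n2 (f i -v proj J v (f i)) + n2 (f i -v proj J u (f i))) / 2)
    by (intros i; unfold w; destruct (Nat.ltb_spec J J); [lia|easy]).
  (* The residual weight is exactly what Bessel's inequality leaves over, so rows sum to
     [n2 (f i)]. *)
  assert (row : forall i, rsum (S J) (w i) = n2 (f i)).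
  { intros i. simpl. rewrite wJ, !n2_residual by apply hs.
    rewrite (rsum_ext J _ (fun k => / 2 * (ip2 (f i) (v k) + ip2 (f i) (u k))))
      by (intros k hk; rewrite wk by easy; field).
    rewrite rsum_scal, rsum_plus. field. }
  assert (w0 : forall i k, 0 <= w i k).
  { intros i k. unfold w. destruct (Nat.ltb_spec k J).
    - generalize (ip2_pos (f i) (v k)) (ip2_pos (f i) (u k)). lra.
    - generalize (n2_pos (f i -v proj J v (f i))) (n2_pos (f i -v proj J u (f i))). lra. }
  assert (main : rsum n (fun i => rpow (Cmod (hinner (T (f i)) (f i))) p)
    <= rsum (S J) (fun k => c k * rpow (s k) p)).
  { apply (substochastic_power_sum p hp n (S J) _ w s c).
    - intros k _. apply hs.
    - auto.
    - intros i hi. rewrite row. now apply bessel_n2_le1 with n.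
    - intros k hk. unfold c. destruct (Nat.ltb_spec k J).
      + rewrite (rsum_ext n _ (fun i => / 2 * (ip2 (v k) (f i) + ip2 (u k) (f i))))
          by (intros i _; rewrite wk, (ip2_sym (v k)), (ip2_sym (u k)) by easy; field).
        rewrite rsum_scal, rsum_plus.
        generalize (hf (v k)) (hf (u k)) (ons_n2_le1 v k (svd_v _ _ _ _ hs))
          (ons_n2_le1 u k (svd_u _ _ _ _ hs)). lra.
      + replace k with J by lia. rewrite <- (Rmult_1_r (INR n)), <- rsum_const.
        apply rsum_le. intros i hi. eapply Rle_trans; [|apply (bessel_n2_le1 f n i hi hf)].
        rewrite <- row. apply (rsum_ge_term (S J) (w i)); [lia|auto].
    - intros i hi. simpl. rewrite wJ.
      rewrite (rsum_ext J _ (fun k => (ip2 (f i) (v k) + ip2 (f i) (u k)) / 2 * s k))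
        by (intros k hk; now rewrite wk).
      now apply svd_quadratic_form_le. }
  eapply Rle_trans; [exact main|]. simpl. apply Rplus_le_compat.
  - eapply Rle_trans; [|apply (hB J)]. right. apply rsum_ext. intros k hk.
    unfold c. destruct (Nat.ltb_spec k J); [ring|lia].
  - unfold c. destruct (Nat.ltb_spec J J); [lia|].
    assert (pn := pos_INR n). assert (q := rpow_pos p (s J)).
    assert (e : / (INR n + 1) * (INR n + 1) = 1) by (field; lra). nra.
Qed.

(** The weak form of T^*T v_j = s_j^2 v_j: of T x, only its component along T v_j meets T v_j. *)
Lemma svd_gram T v u s j x : linear_op T -> svd T v u s ->
  re (T x) (T (v j)) = s j ^ 2 * re x (v j) /\ im (T x) (T (v j)) = s j ^ 2 * im x (v j).
Proof.
  intros hT hs. destruct (Req_dec (s j) 0) as [e|e].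
  { rewrite (svd_zero _ _ _ _ hs j e), linear_0 by easy. autorewrite with inner. lra. }
  set (r := x -v proj (S j) v x).
  assert (dec : T x = hlincomb j (fun k => hinner x (v k)) (fun k => T (v k))
    +v hinner x (v j) *v T (v j) +v T r).
  { rewrite <- linear_lincomb, <- (proj2 hT), <- !(proj1 hT) by easy. f_equal.
    unfold r, proj. simpl. apply vec_ext; intro; inner_simpl; ring. }
  assert (o1 : hinner (hlincomb j (fun k => hinner x (v k)) (fun k => T (v k))) (T (v j)) = C0).
  { apply lincomb_orth. intros i hi. rewrite !(svd_apply _ _ _ _ hs).
    assert (o := proj1 (svd_u _ _ _ _ hs) i j ltac:(lia)).
    apply hinner_eq0; autorewrite with inner; rewrite (re_eq0 _ _ o), (im_eq0 _ _ o); ring. }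
  assert (o2 : hinner (T r) (T (v j)) = C0).
  { assert (o := svd_orth _ _ _ _ hs j r). rewrite (svd_apply _ _ _ _ hs j).
    assert (o' : hinner (T r) (u j) = C0).
    { apply o. intros i hi. apply residual_orth; [apply hs|lia]. }
    apply hinner_eq0; autorewrite with inner; rewrite (re_eq0 _ _ o'), (im_eq0 _ _ o'); ring. }
  assert (nn : re (T (v j)) (T (v j)) = s j ^ 2).
  { fold (n2 (T (v j))). rewrite (svd_apply _ _ _ _ hs), n2_scal, (svd_unit_u _ _ _ _ hs j e).
    unfold cn2; simpl fst; simpl snd. ring. }
  rewrite dec. split; autorewrite with inner;
  rewrite ?(re_eq0 _ _ o1), ?(im_eq0 _ _ o1), ?(re_eq0 _ _ o2), ?(im_eq0 _ _ o2), nn;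
  unfold re, im; ring.
Qed.

(** Factor R0^2 - s_j^2: the vector w = R0 v_j - s_j v_j satisfies R0 w = - s_j w, and positivity of
    R0 forces w = 0. *)
Lemma modulus_svd_eigen T R0 v u s j : linear_op T -> is_modulus T R0 ->
  svd T v u s -> s j <> 0 -> R0 (v j) = (s j, 0) *v v j.
Proof.
  intros hT [hR [_ [hpos hsq]]] hs hj.
  assert (sq : R0 (R0 (v j)) = (s j ^ 2, 0) *v v j).
  { apply vec_ext. intros y. unfold re at 1. rewrite hsq.
    fold (re (T (v j)) (T y)).
    rewrite re_sym, (proj1 (svd_gram T v u s j y hT hs)), re_scal_l, (re_sym (v j) y).
    simpl. ring. }
  set (w := R0 (v j) -v (s j, 0) *v v j).
  assert (ew : R0 w = (- s j, 0) *v w).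
  { unfold w. rewrite linear_sub, (proj2 hR), sq by easy.
    apply vec_ext; intro; inner_simpl; ring. }
  assert (w0 : w = h0).
  { apply n2_eq0. destruct (hpos w) as [_ h]. rewrite ew in h.
    fold (re ((- s j, 0) *v w) w) in h. rewrite re_scal_l in h. simpl in h.
    fold (n2 w) in h. rewrite Rmult_0_l in h.
    assert (p := svd_pos _ _ _ _ hs j). assert (q := n2_pos w). nra. }
  apply vec_ext. intros z. assert (e : re w z = 0) by (rewrite w0; apply re_0_l).
  unfold w in e. rewrite re_add_l, re_opp_l in e. lra.
Qed.

End SingularValueDecomposition.

(** * Comparison with a given sequence of singular values *)

Lemma rsum_delta N m (g : nat -> R) : (m < N)%nat ->
  rsum N (fun n => if Nat.eqb n m then g n else 0) = g m.
Proof.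
  induction N; intros h; [lia|]. simpl. destruct (Nat.eqb_spec N m) as [->|ne].
  - rewrite (rsum_ext _ _ (fun _ => 0)); [rewrite rsum_const; ring|].
    intros i hi. destruct (Nat.eqb_spec i m); [lia|easy].
  - rewrite IHN by lia. ring.
Qed.

Lemma rsum_injective_le J (idx : nat -> nat) g : (forall n, 0 <= g n) ->
  (forall i j, (i < J)%nat -> (j < J)%nat -> idx i = idx j -> i = j) ->
  exists N, rsum J (fun j => g (idx j)) <= rsum N g.
Proof.
  intros hg hinj.
  assert (bd : exists N, forall j, (j < J)%nat -> (idx j < N)%nat).
  { clear hinj. induction J as [|J [N hN]]; [exists O; intros; lia|].
    exists (N + S (idx J))%nat. intros j hj.
    destruct (Nat.eq_dec j J) as [->|ne]; [lia|]. specialize (hN j). lia. }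
  destruct bd as [N hN]. exists N.
  (* Each term is spread out by a Kronecker delta; after exchanging the sums, injectivity lets each
     n be hit at most once. *)
  rewrite (rsum_ext J _ (fun j => rsum N (fun n => if Nat.eqb n (idx j) then g n else 0)))
    by (intros j hj; now rewrite rsum_delta by auto).
  rewrite rsum_swap. apply rsum_le. intros n _. clear hN.
  induction J; simpl; [apply hg|].
  destruct (Nat.eqb_spec n (idx J)) as [e|ne].
  - rewrite (rsum_ext _ _ (fun _ => 0)); [rewrite rsum_const; lra|].
    intros i hi. destruct (Nat.eqb_spec n (idx i)) as [e'|]; [|easy].
    assert (i = J); [|lia]. apply hinj; [lia|lia|congruence].
  - rewrite Rplus_0_r. apply IHJ. intros i j hi hj. apply hinj; lia.
Qed.

Lemma length_filter_rsum (q : nat -> bool) J :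
  INR (length (filter q (seq 0 J))) = rsum J (fun j => if q j then 1 else 0).
Proof.
  induction J; [easy|]. rewrite seq_S, filter_app, length_app, plus_INR, IHJ. simpl.
  destruct (q J); simpl; ring.
Qed.

Section Multiplicities.
Context {H : HilbertSpace}.

(** The v_j with s_j = mu are orthonormal vectors of the mu-eigenspace of R0, which is spanned by k
    vectors. *)
Lemma svd_count_le_eigen_dim (T R0 : H -> H) v u s mu k J :
  linear_op T -> is_modulus T R0 -> svd T v u s -> 0 < mu -> eigen_dim R0 mu k ->
  rsum J (fun j => if Req_EM_T (s j) mu then 1 else 0) <= INR k.
Proof.
  intros hT hR hs hmu [e [_ [_ hspan]]].
  set (w := fun j => if Req_EM_T (s j) mu then v j else h0).
  assert (hw : orthonormal0 w).
  { split.
    - intros i j hij. unfold w. destruct (Req_EM_T (s i) mu), (Req_EM_T (s j) mu);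
      try (apply hinner_eq0; now autorewrite with inner). now apply hs.
    - intros i. unfold w. destruct (Req_EM_T (s i) mu); [apply hs|now left]. }
  destruct (gram_schmidt e) as [g [hg [hin _]]].
  rewrite (rsum_ext J _ (fun j => n2 (w j))).
  - apply trace_le with g; [easy|easy|]. intros j _. unfold w.
    destruct (Req_EM_T (s j) mu) as [ej|_].
    + destruct (hspan (v j)) as [c ->].
      * rewrite <- ej. apply modulus_svd_eigen with T u; try easy. lra.
      * apply in_span_lincomb. intros i hi. now apply in_span_mono with (S i).
    + intros z _. apply hinner_eq0; now autorewrite with inner.
  - intros j _. unfold w. destruct (Req_EM_T (s j) mu); [|now rewrite n2_0].
    rewrite (svd_unit _ _ _ _ hs); [easy|lra].
Qed.

Lemma svd_index_injection (T : H -> H) v u s lam J : linear_op T ->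
  svd T v u s -> singular_values T lam -> (forall j, (j < J)%nat -> s j <> 0) ->
  exists idx : nat -> nat, (forall j, (j < J)%nat -> lam (idx j) = s j) /\
  (forall i j, (i < J)%nat -> (j < J)%nat -> idx i = idx j -> i = j).
Proof.
  intros hT hs [R0 [hR [_ [_ hlam]]]]. induction J; intros hJ.
  { exists (fun j => j). split; intros; lia. }
  destruct IHJ as [idx [h1 h2]]; [auto|].
  assert (hmu : 0 < s J).
  { assert (hJJ := hJ J (Nat.lt_succ_diag_r J)). generalize (svd_pos _ _ _ _ hs J). lra. }
  destruct (hlam (s J) hmu) as [k [hk [l [hnd [hlen hin]]]]].
  set (q := fun j => if Req_EM_T (s j) (s J) then true else false).
  assert (hq : forall j, q j = true <-> s j = s J).
  { intros j. unfold q. now destruct (Req_EM_T (s j) (s J)). }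
  assert (new : exists n, In n l /\ forall j, (j < J)%nat -> idx j <> n).
  { apply NNPP. intros hno.
    (* Otherwise the k indices of value s_J are all images of earlier j with s_j = s_J; together
       with J itself this gives more than k such j. *)
    assert (inc : incl l (map idx (filter q (seq 0 J)))).
    { intros n hn. apply NNPP. intros hnot. apply hno. exists n. split; [easy|].
      intros j hj e. apply hnot. apply in_map_iff. exists j. split; [easy|].
      apply filter_In. split; [apply in_seq; lia|]. apply hq.
      rewrite <- h1 by easy. rewrite e. now apply hin. }
    apply NoDup_incl_length in inc; [|easy]. rewrite length_map, hlen in inc.
    assert (cnt := svd_count_le_eigen_dim T R0 v u s (s J) k (S J) hT hR hs hmu hk).
    rewrite (rsum_ext _ _ (fun j => if q j then 1 else 0)) in cnt
      by (intros j _; unfold q; now destruct (Req_EM_T (s j) (s J))).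
    simpl in cnt. rewrite <- length_filter_rsum in cnt.
    rewrite (proj2 (hq J)) in cnt by easy. apply le_INR in inc. lra. }
  destruct new as [n [hn hnew]]. apply hin in hn.
  exists (fun j => if Nat.eqb j J then n else idx j). split.
  - intros j hj. destruct (Nat.eqb_spec j J) as [->|ne]; [easy|]. apply h1. lia.
  - intros i j hi hj. destruct (Nat.eqb_spec i J) as [->|ni], (Nat.eqb_spec j J) as [->|nj];
    intros e; try easy.
    + destruct (hnew j); [lia|easy].
    + destruct (hnew i); [lia|easy].
    + apply h2; [lia|lia|easy].
Qed.

Lemma svd_power_sum_le p (T : H -> H) v u s lam B : linear_op T -> svd T v u s ->
  singular_values T lam -> (forall N, rsum N (fun n => rpow (lam n) p) <= B) ->
  forall J, rsum J (fun j => rpow (s j) p) <= B.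
Proof.
  intros hT hs hlam hB. induction J; [apply (hB O)|].
  destruct (Req_dec (s J) 0) as [e|ne].
  { simpl. rewrite e, rpow_0. lra. }
  destruct (svd_index_injection T v u s lam (S J) hT hs hlam) as [idx [h1 h2]].
  (* By monotonicity s_J <> 0 makes all earlier values nonzero. *)
  { intros j hj e. apply ne. apply Rle_antisym; [|apply hs]. rewrite <- e.
    apply noninc_le; [apply hs|lia]. }
  destruct (rsum_injective_le (S J) idx (fun n => rpow (lam n) p)) as [N hN];
    [intros; apply rpow_pos|easy|].
  eapply Rle_trans; [|apply (hB N)]. eapply Rle_trans; [|exact hN]. right.
  apply rsum_ext. intros j hj. now rewrite h1.
Qed.

(** Finite Bessel families are the common form of the two test classes: finite parts of orthonormal
    bases, and of frames with upper bound at most 1. *)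
Lemma Schatten_bessel_sum p (T : H -> H) : 1 <= p -> linear_op T -> bounded_op T ->
  in_Schatten p T -> exists c, 0 < c /\ forall n (f : nat -> H),
  (forall x, rsum n (fun i => ip2 x (f i)) <= n2 x) ->
  rsum n (fun i => rpow (Cmod (hinner (T (f i)) (f i))) p) <= c.
Proof.
  intros hp hT hb [hc [lam [hlam [B hB]]]].
  destruct (compact_svd T hT hb hc) as [v [u [s hs]]].
  assert (hB' : forall N, rsum N (fun n => rpow (lam n) p) <= B).
  { intros N. apply Rle_trans with (rsum (S N) (fun n => rpow (lam n) p)).
    - apply rsum_mono; [lia|]. intros; apply rpow_pos.
    - rewrite <- sum_f_R0_rsum.
      apply (growing_ineq (fun N => sum_f_R0 (fun n => rpow (lam n) p) N)); [|easy].
      intros n. simpl. generalize (rpow_pos p (lam (S n))). lra. }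
  exists (B + 1). split; [generalize (hB' O); simpl; lra|].
  intros n f hf. apply (svd_bessel_sum T v u s p B n f hp hT hs); [|easy].
  now apply (svd_power_sum_le p T v u s lam B).
Qed.

End Multiplicities.
Lemma Cmod_Cmul z w : Cmod (Cmul z w) = Cmod z * Cmod w.
Proof.
  rewrite !Cmod_cn2, <- sqrt_mult by apply cn2_pos. f_equal.
  unfold cn2, Cmul; simpl fst; simpl snd. ring.
Qed.

Lemma Cmod_Cconj z : Cmod (Cconj z) = Cmod z.
Proof. rewrite !Cmod_cn2. f_equal. unfold cn2, Cconj; simpl fst; simpl snd. ring. Qed.

Lemma Cmod_pos z : 0 <= Cmod z.
Proof. apply sqrt_pos. Qed.

(** * Diagonalization of the Hermitian part on a finite-dimensional space *)

Section HermitianPart.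
Context {H : HilbertSpace}.
Variables (T : H -> H) (K : R).
Hypothesis T_lin : linear_op T.
Hypothesis K_pos : 0 <= K.
Hypothesis T_bound : forall x, n2 (T x) <= K * n2 x.
Implicit Types x y z : H.

(* The sesquilinear form of the Hermitian part of [T]; no adjoint operator is needed. *)
Definition herm x y : C := ((re (T x) y + re x (T y)) / 2, (im (T x) y + im x (T y)) / 2).

Lemma herm_add x y z : herm (x +v y) z = Cadd (herm x z) (herm y z).
Proof.
  unfold herm, Cadd. rewrite (proj1 T_lin). autorewrite with inner. simpl. f_equal; field.
Qed.

Lemma herm_scal a x y : herm (a *v x) y = Cmul a (herm x y).
Proof.
  unfold herm, Cmul. rewrite (proj2 T_lin). autorewrite with inner. simpl. f_equal; field.
Qed.

Lemma herm_conj x y : herm y x = Cconj (herm x y).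
Proof.
  unfold herm, Cconj. simpl. rewrite (re_sym x (T y)), (re_sym (T x) y),
    (im_sym x (T y)), (im_sym (T x) y). f_equal; field.
Qed.

Lemma herm_0 y : herm h0 y = C0.
Proof. unfold herm. rewrite linear_0 by easy. autorewrite with inner. unfold C0. f_equal; field. Qed.

Lemma Cmod_herm_lincomb n c (w : nat -> H) y :
  Cmod (herm (hlincomb n c w) y) <= rsum n (fun i => Cmod (c i) * Cmod (herm (w i) y)).
Proof.
  induction n; simpl.
  - rewrite herm_0. unfold Cmod, C0. simpl. rewrite Rmult_0_l, Rplus_0_l, sqrt_0. lra.
  - rewrite herm_add. eapply Rle_trans; [apply Cmod_triangle|].
    rewrite herm_scal, Cmod_Cmul. lra.
Qed.

Lemma Cmod_herm_self x : Cmod (herm x x) <= Cmod (hinner (T x) x).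
Proof.
  rewrite !Cmod_cn2. apply sqrt_le_1_alt. unfold herm.
  rewrite (re_sym (T x) x), (im_sym (T x) x). rewrite hinner_re_im.
  unfold cn2; simpl fst; simpl snd. nra.
Qed.

(** The Hermitian form is at most (K+1) n2 x in absolute value on the diagonal, so the shift K + 2
    leaves at least [n2 x]. *)
Definition shifted x y : R := fst (herm x y) + (K + 2) * re x y.

Lemma herm_re_le x y : (fst (herm x y)) ^ 2 <= (K + 1) * (n2 x * n2 y).
Proof.
  unfold herm; simpl fst.
  assert (h1 := cauchy_schwarz (T x) y). assert (h2 := cauchy_schwarz x (T y)).
  rewrite ip2_re_im in h1, h2.
  assert (b1 := T_bound x). assert (b2 := T_bound y).
  assert (px := n2_pos x). assert (py := n2_pos y).
  assert (c1 : n2 (T x) * n2 y <= K * (n2 x * n2 y)) by nra.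
  assert (c2 : n2 x * n2 (T y) <= K * (n2 x * n2 y)) by nra.
  assert (0 <= (re (T x) y - re x (T y)) ^ 2) by apply pow2_ge_0.
  assert (0 <= n2 x * n2 y) by (apply Rmult_le_pos; auto).
  nra.
Qed.

Lemma shifted_form : bounded_form shifted (2 * (K + 1) + 2 * (K + 2) ^ 2).
Proof.
  unfold bounded_form, shifted. split; [nra|].
  split; [intros x y; rewrite (herm_conj y x), (re_sym y x); reflexivity|].
  split; [intros x y z; rewrite herm_add, re_add_l; simpl; ring|].
  split; [intros t x z; rewrite herm_scal, re_scal_l; simpl; ring|].
  intros x y. assert (h := herm_re_le x y). assert (c := cauchy_schwarz x y).
  rewrite ip2_re_im in c.
  assert (0 <= (fst (herm x y) - (K + 2) * re x y) ^ 2) by apply pow2_ge_0.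
  assert (q : re x y ^ 2 <= n2 x * n2 y) by nra.
  assert ((K + 2) ^ 2 * re x y ^ 2 <= (K + 2) ^ 2 * (n2 x * n2 y))
    by (apply Rmult_le_compat_l; [apply pow2_ge_0|easy]).
  nra.
Qed.

Lemma shifted_coercive x : n2 x <= shifted x x.
Proof.
  unfold shifted. assert (h := herm_re_le x x). fold (n2 x).
  assert (px := n2_pos x).
  assert (a : Rabs (fst (herm x x)) <= Rabs ((K + 1) * n2 x)).
  { apply Rsqr_le_abs_0. unfold Rsqr. nra. }
  rewrite (Rabs_pos_eq ((K + 1) * n2 x)) in a by nra.
  generalize (Rle_abs (- fst (herm x x))). rewrite Rabs_Ropp. lra.
Qed.

(** Coercivity ensures that the greedy choice stops only when the span is exhausted, hence that m
    vectors suffice. *)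
Lemma finite_diagonalization m (g : nat -> H) : orthonormal0 g ->
  exists w : nat -> H, orthonormal0 w /\
  (forall i j, i <> j -> herm (w i) (w j) = C0) /\
  (forall x, in_span m g x -> x = proj m w x).
Proof.
  intros hg.
  assert (zero : in_span m g h0)
    by (intros z _; apply hinner_eq0; now autorewrite with inner).
  assert (add : forall x y, in_span m g x -> in_span m g y -> in_span m g (x +v y)).
  { intros x y hx hy z hz. specialize (hx z hz). specialize (hy z hz).
    apply hinner_eq0; autorewrite with inner;
    rewrite ?(re_eq0 _ _ hx), ?(im_eq0 _ _ hx), ?(re_eq0 _ _ hy), ?(im_eq0 _ _ hy); ring. }
  assert (scal : forall a x, in_span m g x -> in_span m g (a *v x)).
  { intros a x hx z hz. specialize (hx z hz). apply hinner_eq0; autorewrite with inner;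
    rewrite ?(re_eq0 _ _ hx), ?(im_eq0 _ _ hx); ring. }
  destruct (greedy_diagonalization shifted _ shifted_form (in_span m g)) as [w [lam hd]];
    [easy|easy|easy| | |].
  - intros u l hu hl z hz. apply (orth_closed u); [easy|]. intros n. now apply hu.
  - intros u hu h1.
    destruct (precompact_subsequence (fun k => proj m g (u k))) as [phi [hphi hc]].
    { apply precompact_lincomb with 1. intros k i _. fold (ip2 (u k) (g i)).
      eapply Rle_trans; [apply cauchy_schwarz|].
      generalize (h1 k) (ons_n2_le1 g i hg) (n2_pos (u k)) (n2_pos (g i)). nra. }
    exists phi. split; [easy|]. intros eps he.
    set (K' := 2 * (K + 1) + 2 * (K + 2) ^ 2).
    assert (hK' : 0 < K' + 1) by (unfold K'; nra).
    destruct (hc (eps / (K' + 1))) as [N hN]; [now apply Rdiv_lt_0_compat|].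
    exists N. intros a b ha hb. specialize (hN a b ha hb). simpl in hN.
    rewrite <- !in_span_proj in hN by auto.
    set (d := u (phi a) -v u (phi b)) in *.
    assert (sq := sqrt_sqrt _ (n2_pos d)). assert (sp := sqrt_pos (n2 d)).
    assert (f := form_small shifted K' shifted_form d d (sqrt (n2 d)) (sqrt (n2 d))
      sp sp (Req_le _ _ (eq_sym sq)) (Req_le _ _ (eq_sym sq))).
    rewrite sq in f. generalize (Rle_abs (shifted d d)).
    assert (e : (K' + 1) * (eps / (K' + 1)) = eps) by (field; lra).
    nra.
  - assert (hw := diag_ons _ _ _ _ hd). exists w. split; [easy|]. split.
    + assert (lt : forall i j, (i < j)%nat -> herm (w i) (w j) = C0).
      { intros i j hij.
        (* Orthogonality cancels the shift; the multiples a = 1 and a = i give the real and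
           imaginary parts. *)
        assert (val : forall a, fst (herm (w i) (a *v w j)) = 0).
        { intros a.
          assert (o : forall k, (k < j)%nat -> hinner (a *v w j) (w k) = C0).
          { intros k hk. assert (o := proj1 hw j k ltac:(lia)).
            apply hinner_eq0; autorewrite with inner;
            rewrite (re_eq0 _ _ o), (im_eq0 _ _ o); ring. }
          assert (h := diag_orth _ _ _ _ hd i (a *v w j)). unfold shifted in h.
          rewrite (re_sym (a *v w j)), (re_eq0 _ _ (o i hij)), Rmult_0_r, Rplus_0_r in h.
          apply h; [apply scal, hd|]. intros k hk. apply o. lia. }
        assert (v1 := val (1, 0)). assert (v2 := val (0, 1)).
        rewrite herm_conj, herm_scal, (herm_conj (w i) (w j)) in v1, v2.
        unfold Cconj, Cmul in v1, v2. simpl in v1, v2.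
        unfold herm in *. unfold C0. simpl in *. f_equal; lra. }
      intros i j hij. destruct (Nat.lt_total i j) as [l|[l|l]]; [now apply lt|easy|].
      rewrite herm_conj, lt by easy. unfold Cconj, C0. simpl. f_equal. ring.
    + intros x hx.
      (* Otherwise w_0, ..., w_m would be m + 1 unit vectors in the span of m vectors. *)
      assert (l0 : lam m = 0).
      { apply NNPP. intros ne.
        assert (t := trace_le (S m) w m g hw hg (fun k _ => diag_mem _ _ _ _ hd k)).
        rewrite (rsum_ext _ _ (fun _ => 1)), rsum_const, S_INR in t; [lra|].
        intros k hk. apply (diag_unit _ _ _ _ hd). intros e. apply ne.
        apply Rle_antisym; [|apply hd]. rewrite <- e.
        apply noninc_le; [apply hd|lia]. }
      set (r := x -v proj m w x).
      assert (hr : in_span m g r).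
      { unfold r. apply add; [easy|]. intros z hz.
        assert (o : hinner (proj m w x) z = C0)
          by (apply lincomb_orth; intros i _; now apply (diag_mem _ _ _ _ hd)).
        apply hinner_eq0; autorewrite with inner; rewrite ?(re_eq0 _ _ o), ?(im_eq0 _ _ o);
        ring. }
      assert (b := diag_bound _ _ _ _ hd m r hr).
      rewrite l0, Rmult_0_l in b.
      assert (r0 : n2 r = 0).
      { apply Rle_antisym; [|apply n2_pos].
        eapply Rle_trans; [apply shifted_coercive|]. apply b.
        intros i hi. now apply residual_orth. }
      apply n2_eq0 in r0. apply vec_ext. intros z.
      assert (e : re r z = 0) by (rewrite r0; apply re_0_l).
      unfold r in e. rewrite re_add_l, re_opp_l in e. lra.
Qed.

(** In the diagonalizing basis w the form is a sum over k of <x,w_k> conj(<y,w_k>)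
    [herm (w k) (w k)]. Averaging the squared coefficients of v_i and u_i gives a matrix with row
    and column sums at most 1, so the diagonal sums over w control everything. *)
Lemma herm_power_sum_le p c (v u : nat -> H) n : 1 <= p ->
  (forall (w : nat -> H) m, orthonormal0 w ->
     rsum m (fun k => rpow (Cmod (hinner (T (w k)) (w k))) p) <= c) ->
  orthonormal0 v -> orthonormal0 u ->
  rsum n (fun i => rpow (Cmod (herm (v i) (u i))) p) <= c.
Proof.
  intros hp hc hv hu.
  destruct (gram_schmidt (fun i => if Nat.ltb i n then v i else u (i - n)%nat))
    as [g [hg [hin _]]].
  set (m := (n + n)%nat).
  assert (sv : forall i, (i < n)%nat -> in_span m g (v i)).
  { intros i hi. apply in_span_mono with (S i); [unfold m; lia|].
    generalize (hin i). destruct (Nat.ltb_spec i n); [easy|lia]. }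
  assert (su : forall i, (i < n)%nat -> in_span m g (u i)).
  { intros i hi. apply in_span_mono with (S (n + i)); [unfold m; lia|].
    generalize (hin (n + i)%nat). destruct (Nat.ltb_spec (n + i) n); [lia|].
    now replace (n + i - n)%nat with i by lia. }
  destruct (finite_diagonalization m g hg) as [w [hw [hdiag hfull]]].
  set (A := fun k => Cmod (herm (w k) (w k))).
  assert (key : forall x y, in_span m g x -> in_span m g y ->
    Cmod (herm x y) <= rsum m (fun k => (ip2 x (w k) + ip2 y (w k)) / 2 * A k)).
  { intros x y hx hy. rewrite (hfull x hx) at 1. unfold proj.
    eapply Rle_trans; [apply Cmod_herm_lincomb|]. apply rsum_le. intros k hk.
    assert (b : Cmod (herm (w k) y) <= Cmod (hinner y (w k)) * A k).
    { rewrite herm_conj, Cmod_Cconj. rewrite (hfull y hy) at 1. unfold proj.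
      eapply Rle_trans; [apply Cmod_herm_lincomb|]. right.
      rewrite (rsum_ext m _ (fun l => if Nat.eqb l k then Cmod (hinner y (w l)) * A l else 0)).
      - now rewrite rsum_delta.
      - intros l _. destruct (Nat.eqb_spec l k) as [->|ne]; [easy|].
        rewrite hdiag by easy. unfold C0, Cmod at 2. simpl.
        rewrite Rmult_0_l, Rplus_0_l, sqrt_0. ring. }
    apply Rle_trans with (Cmod (hinner x (w k)) * (Cmod (hinner y (w k)) * A k)).
    - apply Rmult_le_compat_l; [apply Cmod_pos|easy].
    - rewrite <- Rmult_assoc. apply Rmult_le_compat_r; [apply Cmod_pos|].
      rewrite !Cmod_inner, <- sqrt_mult by apply ip2_pos.
      apply sqrt_mult_le; apply ip2_pos. }
  eapply Rle_trans;
    [apply (substochastic_power_sum p hp n m _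
      (fun i k => (ip2 (v i) (w k) + ip2 (u i) (w k)) / 2) A (fun _ => 1))|].
  - intros k _. apply Cmod_pos.
  - intros i k _ _. generalize (ip2_pos (v i) (w k)) (ip2_pos (u i) (w k)). lra.
  - intros i _. rewrite (rsum_ext m _ (fun k => / 2 * (ip2 (v i) (w k) + ip2 (u i) (w k))))
      by (intros; field). rewrite rsum_scal, rsum_plus.
    generalize (bessel m w (v i) hw) (bessel m w (u i) hw) (ons_n2_le1 v i hv)
      (ons_n2_le1 u i hu). lra.
  - intros k _. rewrite (rsum_ext n _ (fun i => / 2 * (ip2 (w k) (v i) + ip2 (w k) (u i))))
      by (intros; rewrite (ip2_sym (w k)), (ip2_sym (w k)); field).
    rewrite rsum_scal, rsum_plus.
    generalize (bessel n v (w k) hv) (bessel n u (w k) hu) (ons_n2_le1 w k hw). lra.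
  - intros i hi. apply key; auto.
  - eapply Rle_trans; [|apply (hc w m hw)]. apply rsum_le. intros k _.
    rewrite Rmult_1_l. apply rpow_mono; [easy|]. apply Cmod_herm_self.
Qed.

End HermitianPart.

(** * From bounded sums to compactness *)

Section Compactness.
Context {H : HilbertSpace}.
Implicit Types (x y z : H) (T : H -> H).

(** T = A + iB with A and B the Hermitian parts of T and -iT; the diagonal values of -iT have the
    same moduli, so both parts obey the same bound c. *)
Lemma bilinear_power_sum_le T p c (v u : nat -> H) n : 1 <= p ->
  linear_op T -> bounded_op T ->
  (forall (w : nat -> H) m, orthonormal0 w ->
     rsum m (fun k => rpow (Cmod (hinner (T (w k)) (w k))) p) <= c) ->
  orthonormal0 v -> orthonormal0 u ->
  rsum n (fun i => rpow (Cmod (hinner (T (v i)) (u i))) p) <= rpow 2 p * (c + c).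
Proof.
  intros hp hT hb hc hv hu. destruct (bounded_n2 T hb) as [K [hK hKT]].
  set (T' := fun x => (0, -1) *v T x).
  assert (hT' : linear_op T').
  { split; unfold T'.
    - intros x y. rewrite (proj1 hT). apply hscal_distr_v.
    - intros a x. rewrite (proj2 hT). apply vec_ext; intro; inner_simpl; ring. }
  assert (hKT' : forall x, n2 (T' x) <= K * n2 x).
  { intros x. unfold T'. rewrite n2_scal. unfold cn2; simpl fst; simpl snd.
    generalize (hKT x). lra. }
  assert (hc' : forall (w : nat -> H) m, orthonormal0 w ->
     rsum m (fun k => rpow (Cmod (hinner (T' (w k)) (w k))) p) <= c).
  { intros w m hw. eapply Rle_trans; [|apply (hc w m hw)]. right. apply rsum_ext.
    intros k _. f_equal. unfold T'. rewrite !Cmod_inner, ip2_scal_l.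
    f_equal. unfold cn2; simpl fst; simpl snd. ring. }
  assert (h1 := herm_power_sum_le T K hT hK hKT p c v u n hp hc hv hu).
  assert (h2 := herm_power_sum_le T' K hT' hK hKT' p c v u n hp hc' hv hu).
  apply Rle_trans with (rsum n (fun i => rpow 2 p *
    (rpow (Cmod (herm T (v i) (u i))) p + rpow (Cmod (herm T' (v i) (u i))) p))).
  - apply rsum_le. intros i _.
    eapply Rle_trans; [|apply rpow_add; auto using Cmod_pos].
    apply rpow_mono; [easy|].
    replace (hinner (T (v i)) (u i))
      with (Cadd (herm T (v i) (u i)) (Cmul (0, 1) (herm T' (v i) (u i)))).
    + eapply Rle_trans; [apply Cmod_triangle|]. rewrite Cmod_Cmul.
      replace (Cmod (0, 1)) with 1; [lra|]. unfold Cmod. simpl.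
      replace (0 * (0 * 1) + 1 * (1 * 1)) with 1 by ring. now rewrite sqrt_1.
    + rewrite hinner_re_im. unfold herm, Cadd, Cmul, T'. autorewrite with inner. simpl.
      f_equal; field.
  - rewrite rsum_scal, rsum_plus. apply Rmult_le_compat_l; [apply rpow_pos|lra].
Qed.

(** If this failed, unit vectors x_n and y_n could be chosen forever, each orthogonal to its
    predecessors, with |<T x_n, y_n>|^2 >= eps, and the power sums would be unbounded. *)
Lemma small_off_finite_codimension T p c : 1 <= p -> linear_op T ->
  (forall (v u : nat -> H) n, orthonormal0 v -> orthonormal0 u ->
     rsum n (fun i => rpow (Cmod (hinner (T (v i)) (u i))) p) <= c) ->
  forall eps, 0 < eps -> exists m (d d' : nat -> H), forall x y,
    (forall i, (i < m)%nat -> hinner x (d i) = C0) ->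
    (forall i, (i < m)%nat -> hinner y (d' i) = C0) ->
    ip2 (T x) y <= eps * (n2 x * n2 y).
Proof.
  intros hp hT hc eps he. apply NNPP. intros hno.
  destruct (dependent_sequence (h0, h0) (fun n (s : nat -> H * H) (a : H * H) =>
    (forall i, (i < n)%nat -> hinner (fst a) (fst (s i)) = C0) /\
    (forall i, (i < n)%nat -> hinner (snd a) (snd (s i)) = C0) /\
    n2 (fst a) = 1 /\ n2 (snd a) = 1 /\ eps <= ip2 (T (fst a)) (snd a))) as [s hs].
  - intros n s s' a e [h1 [h2 h3]]. split; [|split; [|easy]]; intros i hi;
    rewrite <- e by easy; auto.
  - intros n s. apply NNPP. intros hn. apply hno.
    (* If the choice gets stuck, the vectors chosen so far are the finitely many constraints
       sought. *)
    exists n, (fun i => fst (s i)), (fun i => snd (s i)). intros x y hx hy.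
    apply Rnot_lt_le. intros hlt. apply hn.
    assert (px := n2_pos x). assert (py := n2_pos y).
    assert (sc : ip2 (T x) y = n2 x * n2 y * ip2 (T (normalize x)) (normalize y)).
    { rewrite (normalize_scal x) at 1. rewrite (normalize_scal y) at 1.
      rewrite (proj2 hT), ip2_scal_l, ip2_sym, ip2_scal_l, (ip2_sym (normalize y)).
      unfold cn2; simpl fst; simpl snd. rewrite !pow2_sqrt by easy. ring. }
    assert (gt : n2 x * n2 y * eps < n2 x * n2 y * ip2 (T (normalize x)) (normalize y))
      by lra.
    assert (nz : 0 < n2 x * n2 y).
    { destruct (Req_dec (n2 x * n2 y) 0) as [e|e].
      - rewrite e in gt. lra.
      - assert (0 <= n2 x * n2 y) by now apply Rmult_le_pos. lra. }
    apply Rmult_lt_reg_l in gt; [|easy].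
    exists (normalize x, normalize y). simpl.
    split; [intros i hi; now apply normalize_orth, hx|].
    split; [intros i hi; now apply normalize_orth, hy|].
    split; [|split; [|lra]].
    + destruct (normalize_cases x) as [e|]; [|easy]. exfalso.
      rewrite e, linear_0, ip2_re_im, re_0_l, im_0_l in gt by easy. lra.
    + destruct (normalize_cases y) as [e|]; [|easy]. exfalso.
      rewrite e, ip2_re_im, re_0_r, im_0_r in gt by easy. lra.
  - assert (hv : orthonormal0 (fun i => fst (s i))).
    { split; [|intros i; right; apply hs].
      intros i j hij. destruct (Nat.lt_total i j) as [l|[l|l]]; [|easy|now apply hs].
      now apply hinner_eq0_sym, hs. }
    assert (hu : orthonormal0 (fun i => snd (s i))).
    { split; [|intros i; right; apply hs].
      intros i j hij. destruct (Nat.lt_total i j) as [l|[l|l]]; [|easy|now apply hs].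
      now apply hinner_eq0_sym, hs. }
    assert (hr : 0 < rpow (sqrt eps) p) by now apply rpow_gt0, sqrt_lt_R0.
    destruct (INR_unbounded (c / rpow (sqrt eps) p)) as [n hn].
    assert (b := hc _ _ n hv hu).
    assert (b' : rsum n (fun _ => rpow (sqrt eps) p) <= c).
    { eapply Rle_trans; [|exact b]. apply rsum_le. intros i _. apply rpow_mono; [easy|].
      rewrite Cmod_inner. apply sqrt_le_1_alt, hs. }
    rewrite rsum_const in b'.
    assert (e : c / rpow (sqrt eps) p * rpow (sqrt eps) p = c) by (field; lra). nra.
Qed.

(** T w_k splits into T of a projection, a projection of T r_k, and a remainder y. The first two
    have finite rank and bounded coefficients, so only y needs to be small. *)
Lemma power_sum_compact T p c : 1 <= p -> linear_op T -> bounded_op T ->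
  (forall (v u : nat -> H) n, orthonormal0 v -> orthonormal0 u ->
     rsum n (fun i => rpow (Cmod (hinner (T (v i)) (u i))) p) <= c) ->
  compact_op T.
Proof.
  intros hp hT hb hc w [M0 hM0]. destruct (bounded_n2 T hb) as [K [hK hKT]].
  set (M := M0 * M0).
  assert (hM : forall k, n2 (w k) <= M).
  { intros k. rewrite <- hnorm_sq. unfold Rsqr, M.
    assert (0 <= hnorm (w k)) by apply sqrt_pos. specialize (hM0 k). nra. }
  assert (M_pos : 0 <= M) by (unfold M; nra).
  assert (pc : precompact (fun k => T (w k))).
  { apply precompact_approx. intros eps he.
    assert (he' : 0 < eps / (M + 1)) by (apply Rdiv_lt_0_compat; lra).
    destruct (small_off_finite_codimension T p c hp hT hc _ he') as [m [d [d' hd]]].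
    destruct (gram_schmidt d) as [g [hg [hin _]]].
    destruct (gram_schmidt d') as [g' [hg' [hin' _]]].
    set (r := fun k => w k -v proj m g (w k)).
    assert (hr : forall k, n2 (r k) <= M).
    { intros k. unfold r. rewrite n2_residual by easy.
      assert (0 <= rsum m (fun i => ip2 (w k) (g i)))
        by (apply rsum_pos; intros; apply ip2_pos).
      specialize (hM k). lra. }
    exists (fun k => hlincomb m (fun i => hinner (w k) (g i)) (fun i => T (g i))
       +v proj m g' (T (r k))).
    assert (cs : forall x y B, n2 x <= B -> n2 y <= 1 -> ip2 x y <= B).
    { intros x y B h1 h2. eapply Rle_trans; [apply cauchy_schwarz|].
      generalize (n2_pos x) (n2_pos y). nra. }
    split.
    - apply precompact_add.
      + apply precompact_lincomb with M. intros k i _. apply cs; auto using ons_n2_le1.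
      + apply precompact_lincomb with (K * M). intros k i _. apply cs; auto using ons_n2_le1.
        eapply Rle_trans; [apply hKT|]. apply Rmult_le_compat_l; auto.
    - intros k. set (y := T (r k) -v proj m g' (T (r k))).
      assert (ey : T (w k) -v (hlincomb m (fun i => hinner (w k) (g i)) (fun i => T (g i))
         +v proj m g' (T (r k))) = y).
      { rewrite <- linear_lincomb by easy. fold (proj m g (w k)). unfold y, r.
        rewrite linear_sub by easy. apply vec_ext; intro; inner_simpl; ring. }
      rewrite ey.
      assert (b : ip2 (T (r k)) y <= eps / (M + 1) * (n2 (r k) * n2 y)).
      { apply hd; intros i hi; apply hinner_eq0_sym.
        - apply (hin i). intros j hj. apply residual_orth; [easy|lia].
        - apply (hin' i). intros j hj. apply residual_orth; [easy|lia]. }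
      assert (o : hinner (proj m g' (T (r k))) y = C0).
      { apply lincomb_orth. intros i hi. apply hinner_eq0_sym. now apply residual_orth. }
      (* Since y is the orthogonal residual of T r_k, <T r_k, y> is the squared norm of y; the
         smallness bound then yields n2 y <= eps. *)
      assert (e : ip2 (T (r k)) y = n2 y * n2 y).
      { assert (e1 : T (r k) = y +v proj m g' (T (r k)))
          by (unfold y; apply vec_ext; intro; inner_simpl; ring).
        rewrite e1, ip2_re_im, re_add_l, im_add_l, (re_eq0 _ _ o), (im_eq0 _ _ o), im_self.
        unfold n2. ring. }
      rewrite e in b. assert (py := n2_pos y). specialize (hr k).
      assert (e2 : eps / (M + 1) * (M + 1) = eps) by (field; lra).
      assert (hle : n2 y * n2 y <= eps * n2 y).
      { eapply Rle_trans; [exact b|]. rewrite <- Rmult_assoc.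
        apply Rmult_le_compat_r; [easy|].
        apply Rle_trans with (eps / (M + 1) * (M + 1)); [|lra].
        apply Rmult_le_compat_l; lra. }
      nra. }
  destruct (precompact_subsequence _ pc) as [phi [hphi hca]].
  exists phi. split; [easy|].
  destruct (cauchy_converges _ hca) as [l hl]. exists l. intros eps he.
  destruct (hl (eps * eps)) as [N hN]; [nra|]. exists N. intros n hn.
  apply hnorm_lt; [easy|]. now apply hN.
Qed.

End Compactness.
Lemma threshold (P : nat -> Prop) N : (forall j, P (S j) -> P j) -> ~ P N ->
  exists a, forall j, P j <-> (j < a)%nat.
Proof.
  intros hP.
  assert (mono : forall i j, (i <= j)%nat -> P j -> P i)
    by (intros i j l; induction l; auto).
  induction N; intros hN.
  - exists O. intros j. split; [|lia]. intros hj. destruct hN.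
    apply mono with j; [lia|easy].
  - destruct (classic (P N)) as [y|n]; [|now apply IHN].
    exists (S N). intros j. split.
    + intros hj. apply Nat.nle_gt. intros l. apply hN. now apply mono with j.
    + intros l. apply mono with N; [lia|easy].
Qed.

(** * Construction of the modulus and its eigenspaces *)

Section Modulus.
Context {H : HilbertSpace}.
Variables (T : H -> H) (v u : nat -> H) (s : nat -> R).
Hypothesis T_lin : linear_op T.
Hypothesis T_svd : svd T v u s.
Hypothesis s_lim : forall eps, 0 < eps -> exists N, forall n, (N <= n)%nat -> s n < eps.
Implicit Types x y z : H.

Let v_ons : orthonormal0 v := svd_v _ _ _ _ T_svd.
Let s_pos : forall j, 0 <= s j := svd_pos _ _ _ _ T_svd.

Lemma s_sq_small d N0 : 0 < d -> exists n, (N0 <= n)%nat /\ s n ^ 2 <= d.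
Proof.
  intros hd. destruct (s_lim (sqrt d)) as [N hN]; [now apply sqrt_lt_R0|].
  exists (N0 + N)%nat. split; [lia|]. specialize (hN (N0 + N)%nat ltac:(lia)).
  rewrite <- (sqrt_sqrt d) by lra. generalize (s_pos (N0 + N)%nat). nra.
Qed.

(** Limits are taken by this lemma: every error below is at most a constant times s_n^2. *)
Lemma le0_of_s_sq a K N0 : 0 <= K -> (forall n, (N0 <= n)%nat -> a <= K * s n ^ 2) -> a <= 0.
Proof.
  intros hK h. apply le_epsilon_mult with K; [easy|]. intros d hd.
  destruct (s_sq_small d N0 hd) as [n [hn hs]]. specialize (h n hn). nra.
Qed.

Definition partial_modulus n x : H :=
  hlincomb n (fun j => (s j * re x (v j), s j * im x (v j))) v.

(** Beyond n all factors are at most s_n, and Bessel's inequality bounds the coefficients, uniformly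
    in m. *)
Lemma partial_modulus_diff n m x : (n <= m)%nat ->
  n2 (partial_modulus m x -v partial_modulus n x) <= s n ^ 2 * n2 x.
Proof.
  intros hnm. set (c := fun j => (s j * re x (v j), s j * im x (v j))).
  set (c' := fun j => if Nat.ltb j n then C0 else c j).
  assert (e : partial_modulus m x -v partial_modulus n x = hlincomb m c' v).
  { unfold partial_modulus. fold c. induction hnm.
    - apply vec_ext. intros z. autorewrite with inner. rewrite (re_lincomb_l n c' v).
      rewrite (rsum_ext _ _ (fun _ => 0)); [rewrite rsum_const; ring|].
      intros i hi. unfold c'. destruct (Nat.ltb_spec i n); [|lia]. simpl. ring.
    - simpl. rewrite <- IHhnm. unfold c' at 1. destruct (Nat.ltb_spec m n); [lia|].
      apply vec_ext; intro; inner_simpl; ring. }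
  rewrite e, n2_lincomb_ons by easy.
  apply Rle_trans with (rsum m (fun j => s n ^ 2 * ip2 x (v j))).
  - apply rsum_le. intros j _. rewrite ip2_re_im.
    assert (0 <= n2 (v j) <= 1) by (split; [apply n2_pos|now apply ons_n2_le1]).
    unfold c'. destruct (Nat.ltb_spec j n).
    + unfold cn2, C0. simpl fst; simpl snd. nra.
    + assert (l : s j <= s n) by (apply noninc_le; [apply T_svd|easy]).
      assert (p := s_pos j). assert (l2 : s j ^ 2 <= s n ^ 2) by nra.
      unfold c, cn2; simpl fst; simpl snd.
      set (q := re x (v j) ^ 2 + im x (v j) ^ 2).
      assert (q0 : 0 <= q) by (unfold q; nra).
      replace ((s j * re x (v j)) ^ 2 + (s j * im x (v j)) ^ 2) with (s j ^ 2 * q)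
        by (unfold q; ring).
      assert (s j ^ 2 * q <= s n ^ 2 * q) by now apply Rmult_le_compat_r.
      assert (0 <= s j ^ 2 * q) by (apply Rmult_le_pos; [apply pow2_ge_0|easy]).
      nra.
  - rewrite rsum_scal. apply Rmult_le_compat_l; [apply pow2_ge_0|]. now apply bessel.
Qed.

(** The limit is stated with an explicit rate, which the later estimates use; the factor 2 comes
    from the triangle inequality. *)
Lemma modulus_exists x : exists y, forall n,
  n2 (partial_modulus n x -v y) <= 2 * (s n ^ 2 * n2 x).
Proof.
  destruct (cauchy_converges (fun n => partial_modulus n x)) as [y hy].
  - intros eps he.
    assert (hd : 0 < eps / (4 * (n2 x + 1)))
      by (apply Rdiv_lt_0_compat; generalize (n2_pos x); lra).
    destruct (s_sq_small _ O hd) as [N [_ hN]]. exists N. intros m n hm hn.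
    assert (h1 := partial_modulus_diff N m x hm). assert (h2 := partial_modulus_diff N n x hn).
    generalize (n2_triangle (partial_modulus m x) (partial_modulus N x) (partial_modulus n x)).
    rewrite (n2_sub_sym (partial_modulus N x)).
    assert (px := n2_pos x).
    assert (e : eps / (4 * (n2 x + 1)) * (4 * (n2 x + 1)) = eps) by (field; lra).
    assert (s N ^ 2 * (4 * (n2 x + 1)) <= eps)
      by (eapply Rle_trans; [apply Rmult_le_compat_r; [lra|exact hN]|lra]).
    nra.
  - exists y. intros n. apply Rnot_lt_le. intros hlt.
    destruct (hy ((n2 (partial_modulus n x -v y) - 2 * (s n ^ 2 * n2 x)) / 2)) as [N hN]; [lra|].
    specialize (hN (N + n)%nat ltac:(lia)). simpl in hN.
    assert (h := partial_modulus_diff n (N + n) x ltac:(lia)).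
    rewrite n2_sub_sym in h.
    generalize (n2_triangle (partial_modulus n x) (partial_modulus (N + n) x) y). lra.
Qed.

Definition modulus x : H :=
  proj1_sig (constructive_indefinite_description _ (modulus_exists x)).

Lemma modulus_approx x n : n2 (partial_modulus n x -v modulus x) <= 2 * (s n ^ 2 * n2 x).
Proof.
  exact (proj2_sig (constructive_indefinite_description _ (modulus_exists x)) n).
Qed.

Lemma modulus_ip2_approx x z n :
  ip2 (partial_modulus n x -v modulus x) z <= (2 * (n2 x * n2 z)) * s n ^ 2.
Proof.
  eapply Rle_trans; [apply cauchy_schwarz|].
  assert (h := modulus_approx x n). assert (pz := n2_pos z). nra.
Qed.

Lemma inner_modulus_limit x z a N0 :
  (forall n, (N0 <= n)%nat -> hinner (partial_modulus n x) z = a) ->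
  hinner (modulus x) z = a.
Proof.
  intros h.
  assert (e : cn2 (fst a - re (modulus x) z, snd a - im (modulus x) z) <= 0).
  { apply le0_of_s_sq with (2 * (n2 x * n2 z)) N0.
    - assert (0 <= n2 x * n2 z) by (apply Rmult_le_pos; apply n2_pos). lra.
    - intros n hn. eapply Rle_trans; [|apply (modulus_ip2_approx x z n)].
      specialize (h n hn). rewrite hinner_re_im in h. rewrite <- h.
      rewrite ip2_re_im. autorewrite with inner. unfold cn2; simpl fst; simpl snd.
      right. ring. }
  unfold cn2 in e; simpl fst in e; simpl snd in e. rewrite hinner_re_im.
  destruct a as [a1 a2]. simpl fst in e. simpl snd in e.
  set (d1 := a1 - re (modulus x) z) in e. set (d2 := a2 - im (modulus x) z) in e.
  assert (d1 = 0) by nra. assert (d2 = 0) by nra. unfold d1, d2 in *. f_equal; lra.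
Qed.

Lemma inner_modulus_v x j : hinner (modulus x) (v j) = (s j * re x (v j), s j * im x (v j)).
Proof.
  apply inner_modulus_limit with (S j). intros n hn. rewrite hinner_re_im.
  unfold partial_modulus.
  destruct (inner_lincomb_ons n (fun j => (s j * re x (v j), s j * im x (v j))) v j v_ons)
    as [-> ->].
  destruct (Nat.ltb_spec j n); [|lia]. destruct (ons_inner_n2 v x j v_ons) as [h1 h2].
  simpl. rewrite !Rmult_assoc, h1, h2. reflexivity.
Qed.

Lemma re_modulus_v x j : re (modulus x) (v j) = s j * re x (v j).
Proof. unfold re at 1. now rewrite inner_modulus_v. Qed.

Lemma im_modulus_v x j : im (modulus x) (v j) = s j * im x (v j).
Proof. unfold im at 1. now rewrite inner_modulus_v. Qed.

Lemma inner_modulus_orth x z : (forall j, hinner (v j) z = C0) -> hinner (modulus x) z = C0.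
Proof.
  intros h. apply inner_modulus_limit with O. intros n _. apply lincomb_orth. auto.
Qed.

(** The limit is chosen pointwise, so its algebraic properties follow from this characterization:
    coefficients along v, and nothing orthogonal to all v_j. *)
Lemma modulus_unique x y : (forall j, hinner y (v j) = (s j * re x (v j), s j * im x (v j))) ->
  (forall z, (forall j, hinner (v j) z = C0) -> hinner y z = C0) -> modulus x = y.
Proof.
  intros h1 h2. set (d := modulus x -v y).
  assert (o : forall j, hinner (v j) d = C0).
  { intros j. apply hinner_eq0_sym. specialize (h1 j). rewrite hinner_re_im in h1.
    injection h1 as e1 e2. unfold d.
    apply hinner_eq0; autorewrite with inner;
    rewrite ?re_modulus_v, ?im_modulus_v, ?e1, ?e2; ring. }
  assert (d0 : d = h0).
  { apply n2_eq0. unfold n2, d at 1. rewrite re_add_l, re_opp_l.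
    rewrite (re_eq0 _ _ (inner_modulus_orth x d o)), (re_eq0 _ _ (h2 d o)). ring. }
  apply vec_ext. intros z. assert (e : re d z = 0) by (rewrite d0; apply re_0_l).
  unfold d in e. rewrite re_add_l, re_opp_l in e. lra.
Qed.

Lemma modulus_linear : linear_op modulus.
Proof.
  split.
  - intros x y. apply modulus_unique.
    + intros j. rewrite hinner_re_im. autorewrite with inner.
      rewrite !re_modulus_v, !im_modulus_v. f_equal; ring.
    + intros z hz. assert (e1 := inner_modulus_orth x z hz).
      assert (e2 := inner_modulus_orth y z hz).
      apply hinner_eq0; autorewrite with inner;
      rewrite ?(re_eq0 _ _ e1), ?(im_eq0 _ _ e1), ?(re_eq0 _ _ e2), ?(im_eq0 _ _ e2); ring.
  - intros a x. apply modulus_unique.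
    + intros j. rewrite hinner_re_im. autorewrite with inner.
      rewrite !re_modulus_v, !im_modulus_v. f_equal; ring.
    + intros z hz. assert (e1 := inner_modulus_orth x z hz).
      apply hinner_eq0; autorewrite with inner;
      rewrite ?(re_eq0 _ _ e1), ?(im_eq0 _ _ e1); ring.
Qed.

Lemma modulus_bounded : bounded_op modulus.
Proof.
  exists (sqrt (2 * s O ^ 2)). intros x. unfold hnorm.
  fold (re (modulus x) (modulus x)) (re x x) (n2 (modulus x)) (n2 x).
  rewrite <- sqrt_mult; [|generalize (s_pos O); nra|apply n2_pos].
  (* At n = 0 the partial sum is empty, so the rate itself bounds the modulus. *)
  apply sqrt_le_1_alt. assert (h := modulus_approx x O). unfold partial_modulus in h.
  simpl hlincomb in h. unfold n2 at 1 in h. autorewrite with inner in h.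
  fold (n2 (modulus x)) in h. lra.
Qed.

Lemma modulus_positive : positive_op modulus.
Proof.
  intros x. fold (im (modulus x) x) (re (modulus x) x).
  set (K := 2 * (n2 x * n2 x)).
  assert (hK : 0 <= K) by (unfold K; generalize (n2_pos x); nra).
  assert (e : forall n, re (partial_modulus n x) x = rsum n (fun j => s j * ip2 x (v j))
    /\ im (partial_modulus n x) x = 0).
  { intros n. unfold partial_modulus. rewrite re_lincomb_l, im_lincomb_l. simpl. split.
    - apply rsum_ext. intros j _. rewrite ip2_re_im, (re_sym x (v j)), (im_sym x (v j)). ring.
    - rewrite (rsum_ext _ _ (fun _ => 0)); [rewrite rsum_const; ring|].
      intros j _. rewrite (re_sym x (v j)), (im_sym x (v j)). ring. }
  assert (p : forall n, 0 <= re (partial_modulus n x) x).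
  { intros n. rewrite (proj1 (e n)). apply rsum_pos. intros j _.
    apply Rmult_le_pos; [apply s_pos|apply ip2_pos]. }
  assert (b : forall n, (re (partial_modulus n x) x - re (modulus x) x) ^ 2
     + im (modulus x) x ^ 2 <= K * s n ^ 2).
  { intros n. eapply Rle_trans; [|apply (modulus_ip2_approx x x n)]. right.
    rewrite ip2_re_im. autorewrite with inner. rewrite (proj2 (e n)). ring. }
  split.
  - assert (im (modulus x) x ^ 2 <= 0); [|nra].
    apply le0_of_s_sq with K O; [easy|]. intros n _. specialize (b n).
    generalize (pow2_ge_0 (re (partial_modulus n x) x - re (modulus x) x)). lra.
  - apply Rnot_lt_le. intros hlt.
    assert (re (modulus x) x ^ 2 <= 0); [|nra].
    apply le0_of_s_sq with K O; [easy|]. intros n _. specialize (b n). specialize (p n).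
    assert (0 <= re (partial_modulus n x) x * - re (modulus x) x)
      by (apply Rmult_le_pos; lra).
    assert (0 <= re (partial_modulus n x) x ^ 2) by apply pow2_ge_0.
    assert (0 <= im (modulus x) x ^ 2) by apply pow2_ge_0.
    lra.
Qed.

(** Split y into its projection q on v_0, ..., v_{n-1} and a residual r. On q both sides agree by
    [svd_gram]; on r both are of order s_n. *)
Lemma modulus_square_re x y : re (modulus (modulus x)) y = re (T x) (T y).
Proof.
  set (w := modulus x).
  (* From (a - b)^2 <= 2a^2 + 2b^2 and the bounds [b1] and [b2] below. *)
  set (K := 4 * (n2 w * n2 y) + 2 * (n2 (T x) * n2 y)).
  assert (py := n2_pos y). assert (pw := n2_pos w). assert (pT := n2_pos (T x)).
  assert (hK : 0 <= K) by (unfold K; nra).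
  assert (sq : (re (modulus w) y - re (T x) (T y)) ^ 2 <= 0).
  { apply le0_of_s_sq with K O; [easy|]. intros n _.
    set (q := proj n v y). set (r := y -v q).
    assert (ro : forall i, (i < n)%nat -> hinner r (v i) = C0)
      by (intros; now apply residual_orth).
    assert (nr : n2 r <= n2 y).
    { unfold r, q. rewrite n2_residual by easy.
      assert (0 <= rsum n (fun i => ip2 y (v i)))
        by (apply rsum_pos; intros; apply ip2_pos). lra. }
    assert (pr := n2_pos r).
    assert (eq : re (modulus w) q = re (T x) (T q)).
    { unfold q, proj. rewrite (linear_lincomb T) by easy.
      rewrite (re_sym (hlincomb n _ v)), (re_sym (hlincomb n _ (fun i => T (v i)))).
      rewrite !re_lincomb_l. apply rsum_ext. intros j _.
      destruct (svd_gram T v u s j x T_lin T_svd) as [g1 g2].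
      rewrite (re_sym (modulus w) (v j)), (im_sym (modulus w) (v j)).
      rewrite (re_sym (T x) (T (v j))), (im_sym (T x) (T (v j))), g1, g2.
      rewrite re_modulus_v, im_modulus_v. unfold w. rewrite re_modulus_v, im_modulus_v. ring. }
    assert (ey : y = q +v r) by (unfold r; apply vec_ext; intro; inner_simpl; ring).
    assert (ed : re (modulus w) y - re (T x) (T y) = re (modulus w) r - re (T x) (T r)).
    { rewrite ey at 1 2. rewrite (proj1 T_lin), !re_add_r, eq. ring. }
    rewrite ed.
    assert (b1 : re (modulus w) r ^ 2 <= 2 * (n2 w * n2 y) * s n ^ 2).
    { assert (o : hinner (partial_modulus n w) r = C0)
        by (apply lincomb_orth; intros i hi; now apply hinner_eq0_sym, ro).
      assert (h := modulus_ip2_approx w r n). rewrite ip2_re_im in h.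
      autorewrite with inner in h. rewrite (re_eq0 _ _ o), (im_eq0 _ _ o) in h.
      assert (p2 := pow2_ge_0 (s n)).
      assert (2 * (n2 w * n2 r) * s n ^ 2 <= 2 * (n2 w * n2 y) * s n ^ 2).
      { apply Rmult_le_compat_r; [easy|]. nra. }
      nra. }
    assert (b2 : re (T x) (T r) ^ 2 <= n2 (T x) * n2 y * s n ^ 2).
    { assert (h := cauchy_schwarz (T x) (T r)). rewrite ip2_re_im in h.
      assert (h2 := svd_bound _ _ _ _ T_svd n r ro).
      assert (p2 := pow2_ge_0 (s n)).
      assert (h3 : s n ^ 2 * n2 r <= s n ^ 2 * n2 y) by now apply Rmult_le_compat_l.
      assert (h4 : n2 (T x) * n2 (T r) <= n2 (T x) * (s n ^ 2 * n2 y))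
        by (apply Rmult_le_compat_l; lra).
      nra. }
    assert (0 <= (re (modulus w) r + re (T x) (T r)) ^ 2) by apply pow2_ge_0.
    unfold K. nra. }
  nra.
Qed.

Lemma modulus_is_modulus : is_modulus T modulus.
Proof.
  split; [exact modulus_linear|]. split; [exact modulus_bounded|].
  split; [exact modulus_positive|]. intros x y. rewrite !hinner_re_im. f_equal.
  - apply modulus_square_re.
  - assert (h := modulus_square_re x ((0, 1) *v y)).
    rewrite (proj2 T_lin), !re_scal_r in h. simpl in h. lra.
Qed.

Lemma modulus_v j : modulus (v j) = (s j, 0) *v v j.
Proof.
  apply modulus_unique.
  - intros i. rewrite hinner_re_im. autorewrite with inner. simpl.
    destruct (Nat.eq_dec i j) as [->|ne]; [f_equal; ring|].
    assert (o := proj1 v_ons j i ltac:(auto)).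
    rewrite (re_eq0 _ _ o), (im_eq0 _ _ o). f_equal; ring.
  - intros z hz. apply hinner_eq0; autorewrite with inner;
    rewrite (re_eq0 _ _ (hz j)), (im_eq0 _ _ (hz j)); ring.
Qed.

(** By monotonicity the indices with s_j = mu form an interval. Eigenvectors of different values are
    orthogonal, and as mu > 0 an eigenvector has no part orthogonal to all v_j. *)
Lemma modulus_eigen_interval mu a b : 0 < mu ->
  (forall j, s j = mu <-> (a <= j < b)%nat) -> eigen_dim modulus mu (b - a).
Proof.
  intros hmu hab. exists (fun i => v (a + i)%nat).
  assert (ons : orthonormal0 (fun i => v (a + i)%nat)).
  { split; [|intros i; apply v_ons]. intros i j hij. apply v_ons. lia. }
  split; [|split].
  - intros i hi. rewrite modulus_v. unfold RtoC. do 2 f_equal. apply hab. lia.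
  - intros c hc i hi.
    rewrite <- (lincomb_inner_ons (b - a) c (fun i => v (a + i)%nat) i ons hi).
    + rewrite hc. apply hinner_eq0; now autorewrite with inner.
    + assert (e : s (a + i)%nat = mu) by (apply hab; lia). intros e0.
      assert (h := svd_unit _ _ _ _ T_svd (a + i)%nat ltac:(lra)).
      rewrite e0, n2_0 in h. lra.
  - intros x hx. exists (fun i => hinner x (v (a + i)%nat)).
    fold (proj (b - a) (fun i => v (a + i)%nat) x).
    set (q := proj (b - a) (fun i => v (a + i)%nat) x). set (d := x -v q).
    assert (o : forall j, hinner d (v j) = C0).
    { intros j. destruct (classic (a <= j < b)%nat) as [hj|hj].
      - assert (h := residual_orth (b - a) (fun i => v (a + i)%nat) x (j - a) ons ltac:(lia)).
        simpl in h. now replace (a + (j - a))%nat with j in h by lia.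
      - assert (hne : s j - mu <> 0) by (intros e; apply hj, hab; lra).
        assert (oq : hinner q (v j) = C0).
        { apply lincomb_orth. intros i hi. apply v_ons. lia. }
        assert (e1 := re_modulus_v x j). assert (e2 := im_modulus_v x j).
        rewrite hx in e1, e2. autorewrite with inner in e1, e2. unfold RtoC in e1, e2.
        simpl in e1, e2.
        assert (r0 : re x (v j) = 0) by (apply Rmult_eq_reg_l with (s j - mu); [lra|easy]).
        assert (i0 : im x (v j) = 0) by (apply Rmult_eq_reg_l with (s j - mu); [lra|easy]).
        unfold d. apply hinner_eq0; autorewrite with inner;
        rewrite ?r0, ?i0, ?(re_eq0 _ _ oq), ?(im_eq0 _ _ oq); ring. }
    assert (o' : forall j, hinner (v j) d = C0) by (intros; now apply hinner_eq0_sym).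
    assert (xd : re x d = 0).
    { assert (h := re_eq0 _ _ (inner_modulus_orth x d o')). rewrite hx, re_scal_l in h.
      unfold RtoC in h. simpl in h. apply Rmult_eq_reg_l with mu; lra. }
    assert (qd : re q d = 0) by (apply re_eq0, lincomb_orth; intros; apply o').
    assert (d0 : d = h0).
    { apply n2_eq0. unfold n2, d at 1. rewrite re_add_l, re_opp_l, xd, qd. ring. }
    apply vec_ext. intros z. assert (e : re d z = 0) by (rewrite d0; apply re_0_l).
    unfold d in e. rewrite re_add_l, re_opp_l in e. lra.
Qed.

Lemma svd_singular_values : singular_values T s.
Proof.
  exists modulus. split; [exact modulus_is_modulus|]. split; [exact s_pos|].
  split; [apply T_svd|]. intros mu hmu.
  assert (dec := svd_noninc _ _ _ _ T_svd).
  destruct (s_lim mu hmu) as [N hN]. specialize (hN N (Nat.le_refl N)).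
  (* The interval runs from the first index with s_j <= mu to the first with s_j < mu. *)
  destruct (threshold (fun j => mu < s j) N) as [a ha].
  { intros j h. specialize (dec j). lra. } { lra. }
  destruct (threshold (fun j => mu <= s j) N) as [b hb].
  { intros j h. specialize (dec j). lra. } { lra. }
  assert (hab : forall j, s j = mu <-> (a <= j < b)%nat).
  { intros j. specialize (ha j). specialize (hb j). split.
    - intros e. split.
      + apply Nat.nlt_ge. intros h. apply ha in h. lra.
      + apply hb. lra.
    - intros [h1 h2]. apply hb in h2. apply Rle_antisym; [|easy].
      apply Rnot_lt_le. intros h. apply ha in h. lia. }
  exists (b - a)%nat. split; [now apply modulus_eigen_interval|].
  exists (seq a (b - a)). split; [apply seq_NoDup|]. split; [apply length_seq|].
  intros n. rewrite in_seq, hab. lia.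
Qed.

End Modulus.

(** * Bases, frames and the equivalences *)

Section Equivalence.
Context {H : HilbertSpace}.
Implicit Types (T : H -> H).

Lemma orthonormal_sum_Schatten T p c : 1 <= p -> linear_op T -> bounded_op T ->
  (forall (w : nat -> H) m, orthonormal0 w ->
     rsum m (fun k => rpow (Cmod (hinner (T (w k)) (w k))) p) <= c) ->
  in_Schatten p T.
Proof.
  intros hp hT hb hc.
  assert (hG := fun v u n => bilinear_power_sum_le T p c v u n hp hT hb hc).
  set (c' := rpow 2 p * (c + c)) in hG.
  assert (cT := power_sum_compact T p c' hp hT hb hG).
  destruct (compact_svd T hT hb cT) as [v [u [s hs]]].
  (* The bilinear bound at the singular vectors, where |<T v_j, u_j>| = s_j. *)
  assert (hB : forall n, rsum n (fun j => rpow (s j) p) <= c').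
  { intros n. eapply Rle_trans; [|apply (hG v u n); apply hs]. right.
    apply rsum_ext. intros j _. f_equal.
    rewrite (svd_apply _ _ _ _ hs), Cmod_inner, ip2_scal_l.
    assert (p0 := svd_pos _ _ _ _ hs j).
    destruct (Req_dec (s j) 0) as [e|e].
    - rewrite e. unfold cn2; simpl fst; simpl snd.
      replace ((0 ^ 2 + 0 ^ 2) * ip2 (u j) (u j)) with 0 by ring. now rewrite sqrt_0.
    - rewrite ip2_re_im, im_self. fold (n2 (u j)). rewrite (svd_unit_u _ _ _ _ hs j e).
      unfold cn2; simpl fst; simpl snd.
      replace ((s j ^ 2 + 0 ^ 2) * (1 ^ 2 + 0 ^ 2)) with (s j * s j) by ring.
      now rewrite sqrt_square. }
  split; [easy|]. exists s. split.
  - apply svd_singular_values with v u; [easy|easy|].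
    apply (summable_small p s c'); [easy|apply hs|easy].
  - destruct (growing_cv (fun N => sum_f_R0 (fun n => rpow (s n) p) N)) as [l hl].
    + intros n. simpl. generalize (rpow_pos p (s (S n))). lra.
    + exists c'. intros t [n ->]. rewrite sum_f_R0_rsum. apply hB.
    + now exists l.
Qed.

(** A basis may not contain zero vectors, so it is indexed by the positions of the nonzero ones. *)
Lemma ons_basis_sum_list (e : nat -> H) (g : nat -> R) n :
  (forall i, e i = h0 -> g i = 0) ->
  exists l : list {i | e i <> h0}, NoDup l /\
    (forall j, In j l -> (proj1_sig j < n)%nat) /\
    fold_right Rplus 0 (map (fun j => g (proj1_sig j)) l) = rsum n g.
Proof.
  intros hg. induction n as [|n [l [h1 [h2 h3]]]].
  { exists nil. split; [constructor|]. easy. }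
  destruct (classic (e n = h0)) as [e0|ne].
  - exists l. split; [easy|]. split; [intros j hj; specialize (h2 j hj); lia|].
    simpl. rewrite h3, (hg n e0). ring.
  - exists (exist _ n ne :: l). split; [|split].
    + constructor; [|easy]. intros hin. apply h2 in hin. simpl in hin. lia.
    + intros j [<-|hj]; [simpl; lia|]. specialize (h2 j hj). lia.
    + simpl. rewrite h3. ring.
Qed.

Lemma fold_right_map_nth {A : Type} (g : H -> R) (e : A -> H) l :
  fold_right Rplus 0 (map (fun i => g (e i)) l)
  = rsum (length l) (fun i => g (nth i (map e l) h0)).
Proof.
  (* [rsum] grows at the end, hence induction on the reversed list. *)
  rewrite <- (rev_involutive l). generalize (rev l). intros k. clear l.
  assert (fapp : forall (xs : list R) y,
    fold_right Rplus 0 (xs ++ y :: nil) = fold_right Rplus 0 xs + y).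
  { intros xs y. induction xs; simpl; [ring|]. rewrite IHxs. ring. }
  induction k as [|a k IH]; [easy|]. simpl rev.
  rewrite map_app, length_app, Nat.add_1_r. simpl. rewrite fapp, IH. f_equal.
  - apply rsum_ext. intros i hi. rewrite map_app, app_nth1; [easy|].
    now rewrite length_map.
  - rewrite map_app, app_nth2; rewrite length_map; [|lia]. now rewrite Nat.sub_diag.
Qed.

Lemma parseval_vanish (e : nat -> H) x :
  (forall eps, 0 < eps -> exists N, forall m, (N <= m)%nat ->
     n2 x - eps < rsum m (fun i => ip2 x (e i))) ->
  (forall i, hinner x (e i) = C0) -> x = h0.
Proof.
  intros hp h. apply n2_eq0. apply Rle_antisym; [|apply n2_pos].
  apply Rnot_lt_le. intros hlt. destruct (hp _ hlt) as [N hN].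
  specialize (hN N (Nat.le_refl N)).
  rewrite (rsum_ext _ _ (fun _ => 0)), rsum_const in hN; [lra|].
  intros i _. rewrite ip2_re_im, (re_eq0 _ _ (h i)), (im_eq0 _ _ (h i)). ring.
Qed.

Lemma Cmod_inner_0 T : linear_op T -> Cmod (hinner (T h0) h0) = 0.
Proof.
  intros hT. rewrite Cmod_inner, ip2_re_im, re_0_r, im_0_r.
  replace (0 ^ 2 + 0 ^ 2) with 0 by ring. apply sqrt_0.
Qed.

Lemma basis_sum_orthonormal_sum T p c : linear_op T ->
  (forall (I : Type) (e : I -> H), countable_type I -> orthonormal_basis I e ->
     sum_le (fun i => rpow (Cmod (hinner (T (e i)) (e i))) p) c) ->
  forall (w : nat -> H) m, orthonormal0 w ->
  rsum m (fun k => rpow (Cmod (hinner (T (w k)) (w k))) p) <= c.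
Proof.
  intros hT hc w m hw. destruct (ons_extend w m hw) as [e [he [hew hpar]]].
  set (g := fun i => rpow (Cmod (hinner (T (e i)) (e i))) p).
  assert (hg : forall i, e i = h0 -> g i = 0).
  { intros i e0. unfold g. now rewrite e0, Cmod_inner_0, rpow_0. }
  destruct (ons_basis_sum_list e g m hg) as [l [nd [_ hl]]].
  rewrite (rsum_ext m _ g) by (intros i hi; unfold g; now rewrite hew).
  rewrite <- hl.
  apply (hc {i | e i <> h0} (fun j => e (proj1_sig j))); [| |easy].
  - exists (fun j => proj1_sig j). intros [i hi] [j hj] eij. simpl in eij.
    subst j. f_equal. apply proof_irrelevance.
  - split; [|split].
    + intros [i hi]. simpl. rewrite hinner_re_im, im_self. fold (n2 (e i)).
      now rewrite (ons_unit e i he hi).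
    + intros [i hi] [j hj] ne. simpl. apply he. intros eij. apply ne. subst j.
      f_equal. apply proof_irrelevance.
    + intros x hx. apply (parseval_vanish e); [auto|]. intros i.
      destruct (classic (e i = h0)) as [->|ne].
      * apply hinner_eq0; now autorewrite with inner.
      * exact (hx (exist _ i ne)).
Qed.

Lemma parseval_frame_bounds (e : nat -> H) : orthonormal0 e ->
  (forall x eps, 0 < eps -> exists N, forall m, (N <= m)%nat ->
     n2 x - eps < rsum m (fun i => ip2 x (e i))) -> frame_bounds e 1 1.
Proof.
  intros he hp. split; [lra|]. split; [lra|]. intros x. exists (n2 x).
  rewrite hnorm_sq. split; [|lra].
  assert (sq : forall i, Rsqr (Cmod (hinner x (e i))) = ip2 x (e i)).
  { intros i. rewrite Cmod_inner. apply Rsqr_sqrt, ip2_pos. }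
  intros eps heps. destruct (hp x eps heps) as [N hN]. exists N. intros n hn.
  rewrite sum_f_R0_rsum, (rsum_ext _ _ (fun i => ip2 x (e i))) by (intros; apply sq).
  assert (h1 := hN (S n) ltac:(lia)). assert (h2 := bessel (S n) e x he).
  unfold Rdist. apply Rabs_def1; lra.
Qed.

Lemma frame_sum_orthonormal_sum T p c :
  (forall f : nat -> H, is_frame f -> (exists B, upper_frame_bound f B /\ B <= 1) ->
     forall N, sum_f_R0 (fun n => rpow (Cmod (hinner (T (f n)) (f n))) p) N <= c) ->
  forall (w : nat -> H) m, orthonormal0 w ->
  rsum m (fun k => rpow (Cmod (hinner (T (w k)) (w k))) p) <= c.
Proof.
  intros hc w m hw. destruct (ons_extend w m hw) as [e [he [hew hpar]]].
  assert (fb := parseval_frame_bounds e he hpar).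
  rewrite (rsum_ext m _ (fun i => rpow (Cmod (hinner (T (e i)) (e i))) p))
    by (intros i hi; now rewrite hew).
  apply Rle_trans with (rsum (S m) (fun i => rpow (Cmod (hinner (T (e i)) (e i))) p)).
  { apply rsum_mono; [lia|]. intros; apply rpow_pos. }
  rewrite <- sum_f_R0_rsum. apply hc; [now exists 1, 1|].
  (* The upper frame bound, an infimum, is obtained as the negated supremum of the negated bounds;
     -1 lies in E because (1, 1) is admissible. *)
  set (E := fun t => exists C1', frame_bounds e C1' (- t)).
  destruct (completeness E) as [b [hub hlub]].
  - exists 0. intros t [C1' [h1 [h2 _]]]. lra.
  - exists (-1), 1. now replace (- -1) with 1 by ring.
  - exists (- b). split; [split|].
    + intros t [C1' ht]. assert (- t <= b); [|lra]. apply hub. exists C1'.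
      now rewrite Ropp_involutive.
    + intros b' hb'. assert (b <= - b'); [|lra]. apply hlub. intros t [C1' ht].
      assert (b' <= - t); [|lra]. apply hb'. now exists C1'.
    + assert (-1 <= b); [|lra]. apply hub. exists 1. now replace (- -1) with 1 by ring.
Qed.

(** The infimum need not be known to be attained: if a partial sum exceeded [n2 x], the ratio t > 1
    would be below every admissible bound, hence at most B. *)
Lemma frame_bessel (f : nat -> H) B n x : upper_frame_bound f B -> B <= 1 ->
  rsum n (fun i => ip2 x (f i)) <= n2 x.
Proof.
  intros [hlb hglb] hB. apply Rnot_lt_le. intros hlt.
  assert (px := n2_pos x).
  assert (hx : 0 < n2 x).
  { destruct (Req_dec (n2 x) 0) as [e|e]; [|lra]. exfalso.
    rewrite (n2_eq0 x e), n2_0, (rsum_ext _ _ (fun _ => 0)), rsum_const in hlt; [lra|].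
    intros i _. rewrite ip2_re_im, re_0_l, im_0_l. ring. }
  set (t := rsum n (fun i => ip2 x (f i)) / n2 x) in *.
  assert (et : t * n2 x = rsum n (fun i => ip2 x (f i))) by (unfold t; field; lra).
  assert (ht : 1 < t) by nra.
  assert (t <= B); [|lra]. apply hglb. intros C2' [C1' [_ [_ hf]]].
  destruct (hf x) as [sm [hcv [_ hle]]]. rewrite hnorm_sq in hle.
  assert (hs : rsum n (fun i => ip2 x (f i)) <= sm).
  { apply Rle_trans with (rsum (S n) (fun i => ip2 x (f i))).
    - apply rsum_mono; [lia|]. intros; apply ip2_pos.
    - rewrite (rsum_ext _ _ (fun i => Rsqr (Cmod (hinner x (f i)))))
        by (intros; rewrite Cmod_inner, Rsqr_sqrt; auto using ip2_pos).
      rewrite <- sum_f_R0_rsum.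
      apply (growing_ineq (fun N => sum_f_R0 (fun n => Rsqr (Cmod (hinner x (f n)))) N));
        [|easy].
      intros k. simpl. generalize (Rle_0_sqr (Cmod (hinner x (f (S k))))). lra. }
  apply Rmult_le_reg_r with (n2 x); lra.
Qed.

(** The default h0 of [nth] extends the finite system by zero vectors, as [orthonormal0] permits. *)
Lemma basis_list_ons {A : Type} (e : A -> H) l : orthonormal_basis A e -> NoDup l ->
  orthonormal0 (fun i => nth i (map e l) h0).
Proof.
  intros [h1 [h2 _]] nd.
  assert (hn : forall i, (length l <= i)%nat -> nth i (map e l) h0 = h0)
    by (intros i hi; apply nth_overflow; now rewrite length_map).
  assert (ha : forall i, (i < length l)%nat -> exists a, nth_error l i = Some a /\
    nth i (map e l) h0 = e a).
  { intros i hi. destruct (nth_error l i) as [a|] eqn:ea.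
    - exists a. split; [easy|]. apply nth_error_nth. rewrite nth_error_map, ea. reflexivity.
    - apply nth_error_None in ea. lia. }
  split.
  - intros i j hij.
    destruct (Nat.le_gt_cases (length l) i) as [li|li];
      [rewrite hn by easy; apply hinner_eq0; now autorewrite with inner|].
    destruct (Nat.le_gt_cases (length l) j) as [lj|lj];
      [rewrite (hn j) by easy; apply hinner_eq0; now autorewrite with inner|].
    destruct (ha i li) as [a [ea ->]]. destruct (ha j lj) as [b [eb ->]].
    apply h2. intros eab. subst b. apply hij.
    apply (proj1 (NoDup_nth_error l) nd); [easy|congruence].
  - intros i. destruct (Nat.le_gt_cases (length l) i) as [li|li]; [left; auto|right].
    destruct (ha i li) as [a [_ ->]]. unfold n2, re. now rewrite h1.
Qed.

End Equivalence.

Theorem theorem8 (H : HilbertSpace) (p : R) (T : H -> H) :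
  1 <= p -> linear_op T -> bounded_op T ->
  (in_Schatten p T <->
     exists c, 0 < c /\
       forall (I : Type) (e : I -> H), countable_type I -> orthonormal_basis I e ->
         sum_le (fun i => rpow (Cmod (hinner (T (e i)) (e i))) p) c) /\
  (in_Schatten p T <->
     exists c, 0 < c /\
       forall f : nat -> H,
         is_frame f -> (exists B, upper_frame_bound f B /\ B <= 1) ->
         forall N, sum_f_R0 (fun n => rpow (Cmod (hinner (T (f n)) (f n))) p) N <= c).
Proof.
  intros hp hT hb. split; split.
  - intros hS. destruct (Schatten_bessel_sum p T hp hT hb hS) as [c [c0 hc]].
    exists c. split; [easy|]. intros I e _ he l nd.
    rewrite (fold_right_map_nth (fun x => rpow (Cmod (hinner (T x) x)) p)).
    apply (hc (length l) (fun i => nth i (map e l) h0)). intros x.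
    apply bessel. now apply basis_list_ons.
  - intros [c [_ hc]]. apply (orthonormal_sum_Schatten T p c hp hT hb).
    now apply basis_sum_orthonormal_sum.
  - intros hS. destruct (Schatten_bessel_sum p T hp hT hb hS) as [c [c0 hc]].
    exists c. split; [easy|]. intros f _ [B [hB hB1]] N. rewrite sum_f_R0_rsum.
    apply hc. intros x. now apply frame_bessel with B.
  - intros [c [_ hc]]. apply (orthonormal_sum_Schatten T p c hp hT hb).
    now apply frame_sum_orthonormal_sum.
Qed.
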